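(* Let $T_0$ be the standard tiling of $P_n$. If $(T_0,F)$ is a generic network (with $F(v_0)=1$), then there is a unique $A\in M_n^*(\mathbb{C})$ such that $F_{A,T_0}=F$ on $U(T_0)$. The map $A\mapsto(T_0,F_{A,T_0})$ and the map $\Psi$ mapping $(T_0,F)$ to $A$ are two-sided inverses.
   Context: $[n]=\{1,\dots,n\}$; $A_X^Y$ is the submatrix of $A$ with rows $X$ and columns $Y$; the empty determinant is 1. $M_n^*(\mathbb{C})$ is the set of generic $n\times n$ complex matrices, meaning those with only nonzero minors. An almost-principal minor $\det A_{S\cup\{i\}}^{S\cup\{j\}}$ ($i\neq j$, $i,j\notin S$) is odd if $(i-j)(-1)^{|S|}>0$. Tilings: let $e_j=e^{\pi i(j-1)/n}\in\mathbb{R}^2$, and let $P_n$ be the regular $2n$-gon with unit edges which is the convex hull of $\{\sum_{j\in S}e_j:S\subseteq[n]\}$; $v_0=0$. A tiling $T$ of $P_n$ is a tiling by translates of the unit rhombi with edges parallel to $e_j,e_k$ ($j<k$), each occurring exactly once. Each vertex $v$ of $T$ corresponds to the subset $S\subseteq[n]$ of those $j$ such that $e_j$ is a step of a shortest path along tiling edges from $v_0$ to $v$. Put $\sigma(v)=(-1)^{\lfloor d/2\rfloor}$, where $d=|S|$ is the graph distance from $v$ to $v_0$ in the tiling. $U(T)$ is the set of vertices and rhombi (faces) of $T$; the rhombus with vertex subsets $S,S\cup\{i\},S\cup\{i,j\},S\cup\{j\}$ is denoted $\langle S;i,j\rangle$. The standard tiling $T_0$ is the tiling whose vertices are exactly the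 points $\sum_{j\in G}e_j$ with $G$ a (possibly empty) set of consecutive elements of $[n]$; its rhombi are $\langle\{i+1,\dots,j-1\};i,j\rangle$, $i<j$. A network is a pair $(T,F)$ with $T$ a tiling and $F$ a real or complex function on $U(T)$. For a matrix $A$, $F_{A,T}(v)=\sigma(v)\det A_S^S$ at a vertex $v$ corresponding to $S$, and, for $i<j$ and $S$ corresponding to $v$, $F_{A,T}(\langle S;i,j\rangle)$ is $\sigma(v+e_i)$ times whichever of $\det A_{S\cup\{j\}}^{S\cup\{i\}}$, $\det A_{S\cup\{i\}}^{S\cup\{j\}}$ is odd. Cube moves: three tiles of $T$ whose union is a hexagon span a Boolean interval $[S,S\cup\{p,q,r\}]$, $p<q<r$; writing $Sq=S\cup\{q\}$ etc., the center vertex is $Sq$ (with faces $\langle S;p,q\rangle,\langle S;q,r\rangle,\langle Sq;p,r\rangle$) or $Spr$ (with faces $\langle S;p,r\rangle,\langle Sr;p,q\rangle,\langle Sp;q,r\rangle$). A cube move replaces one configuration by the other; the values at the center and three faces are replaced so that the hexahedron relation holds, all other values being unchanged. Here $a_8=F(S)$, $a_4=F(Sp)$, $a_0=F(Sq)$, $a_6=F(Sr)$, $a_9=F(Spq)$, $a_0^*=F(Spr)$, $a_7=F(Sqr)$, $a_5=F(Spqr)$, $a_1=F(\langle S;p,q\rangle)$, $a_3=F(\langle S;q,r\rangle)$, $a_2=F(\langle Sq;p,r\rangle)$, $a_2^*=F(\langle S;p,r\rangle)$, $a_1^*=F(\langle Sr;p,q\rangle)$, $a_3^*=F(\langle Sp;q,r\rangle)$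 (the star is only a label), and the hexahedron relation is $$a_1^*a_1a_0=a_1a_2a_3+a_7a_8a_9+a_0a_4a_7,\quad a_2^*a_2a_0=a_1a_2a_3+a_7a_8a_9+a_0a_5a_8,\quad a_3^*a_3a_0=a_1a_2a_3+a_7a_8a_9+a_0a_6a_9,$$ $$a_0^*a_0^2a_1a_2a_3=(a_1a_2a_3)^2+a_1a_2a_3(2a_7a_8a_9+a_0a_4a_7+a_0a_5a_8+a_0a_6a_9)+(a_8a_9+a_0a_4)(a_9a_7+a_0a_5)(a_7a_8+a_0a_6).$$ Two networks are equivalent if one can be obtained from the other by a sequence of cube moves and multiplications of all values by a single nonzero constant. A network is generic if it and all equivalent networks have only nonzero values.
   Formalization: M_n^* is taken as matrices with nonzero principal and odd almost-principal minors (with all minors nonzero the claim fails for n=2); a cube move from center Spr to Sq is the inverse of the opposite move, excluding spurious zero solutions of the hexahedron relation; n ≥ 2. *)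

(* Defs.v *)
From HB Require Import structures.
From Stdlib Require Import Relation_Operators.
From mathcomp Require Import all_boot all_order all_algebra.
From mathcomp Require Import complex.
From mathcomp Require Import ring.
From mathcomp Require Import all_classical all_reals all_analysis.

Set Implicit Arguments.
Unset Strict Implicit.
Unset Printing Implicit Defensive.

Import Order.TTheory GRing.Theory Num.Theory.

Local Open Scope ring_scope.

(* The index set [n] = {1, ..., n} is 'I_n = {0, ..., n-1}: the ordinal j stands
   for j + 1.  The complex numbers are R[i] for R : realType, and the plane R^2
   is identified with R[i]. *)

(** * Minors *)

(* [conform_mx] only casts the submatrix with rows X and columns Y to a square
   format; it is used with #|X| = #|Y| (otherwise the value is junk). *)
Definition minor (K : comNzRingType) n (A : 'M[K]_n) (X Y : {set 'I_n}) : K :=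
  \det (conform_mx (0 : 'M[K]_#|X|)
    (mxsub (fun k : 'I_#|X| => enum_val k) (fun k : 'I_#|Y| => enum_val k) A)).

Definition odd_ap n (S : {set 'I_n}) (i j : 'I_n) : bool :=
  0 < ((i : nat)%:Z - (j : nat)%:Z) * (-1) ^+ #|S|.

(* M_n^*: the nonzero minors are those a network records, i.e. the principal
   ones and the odd almost-principal ones.  The other minors of the matrix of a
   generic network may vanish: for n = 2 the network with value -1 at the top
   vertex and 1 elsewhere is generic, and its only matrix has rows (1, 0) and
   (1, 1). *)
Definition generic_mx (K : comNzRingType) n (A : 'M[K]_n) : Prop :=
  (forall S : {set 'I_n}, minor A S S != 0) /\
  (forall (S : {set 'I_n}) (i j : 'I_n),
     i != j -> i \notin S -> j \notin S -> odd_ap S i j ->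
     minor A (i |: S) (j |: S) != 0).

(** * Tilings *)

(* [T i j], for i < j, is the vertex subset S of the rhombus <S; i, j>; the
   other values of T are irrelevant. *)
Definition tiles n := 'I_n -> 'I_n -> {set 'I_n}.

Section Geometry.
Variables (R : realType) (n : nat).
Implicit Types (S : {set 'I_n}) (i j k : 'I_n) (T : tiles n) (v w z : R[i]).

Definition edge_vec k : R[i] :=
  (cos (pi * k%:R / n%:R) +i* sin (pi * k%:R / n%:R))%C.

Definition pt S : R[i] := \sum_(k in S) edge_vec k.

Definition polygon : set R[i] := fun z =>
  exists w : {set 'I_n} -> R,
    [/\ forall S, 0 <= w S, \sum_S w S = 1 & z = \sum_S (w S)%:C%C * pt S].

Definition rhombus S i j : set R[i] := fun z =>
  exists s t : R, [/\ 0 <= s <= 1, 0 <= t <= 1 &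
    z = pt S + s%:C%C * edge_vec i + t%:C%C * edge_vec j].

Definition open_rhombus S i j : set R[i] := fun z =>
  exists s t : R, [/\ 0 < s < 1, 0 < t < 1 &
    z = pt S + s%:C%C * edge_vec i + t%:C%C * edge_vec j].

(* [v, v + e_k] is an edge of some tile. *)
Definition tile_edge T v k : Prop :=
  exists i j : 'I_n, (i < j)%N /\
    [\/ k = i /\ (v = pt (T i j) \/ v = pt (j |: T i j))
      | k = j /\ (v = pt (T i j) \/ v = pt (i |: T i j))].

(* Step (k, true) adds e_k, step (k, false) subtracts it. *)
Inductive walk T : R[i] -> seq ('I_n * bool) -> R[i] -> Prop :=
| walk_nil v : walk T v [::] v
| walk_up v k s w : tile_edge T v k ->
    walk T (v + edge_vec k) s w -> walk T v ((k, true) :: s) w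
| walk_down v k s w : tile_edge T (v - edge_vec k) k ->
    walk T (v - edge_vec k) s w -> walk T v ((k, false) :: s) w.

Definition shortest_walk T v s w : Prop :=
  walk T v s w /\ forall s', walk T v s' w -> (size s <= size s')%N.

End Geometry.
Arguments polygon {R} n _.

Definition is_vertex n (T : tiles n) (S : {set 'I_n}) : Prop :=
  exists i j : 'I_n, (i < j)%N /\
    S \in [:: T i j; i |: T i j; j |: T i j; i |: (j |: T i j)].

(* Distinct points may not determine their subset (e_2 = e_1 + e_3 for n = 3),
   so the last field ties the subset labels to the paths of the tiling, which
   start at v_0 = 0. *)
Record is_tiling (R : realType) n (T : tiles n) : Prop := IsTiling {
  tile_notin : forall i j : 'I_n, (i < j)%N -> i \notin T i j /\ j \notin T i j;
  tile_cover : forall z : R[i],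
    polygon n z <-> exists i j : 'I_n, (i < j)%N /\ rhombus (T i j) i j z;
  tile_disjoint : forall (i j k l : 'I_n) (z : R[i]), (i < j)%N -> (k < l)%N ->
    open_rhombus (T i j) i j z -> open_rhombus (T k l) k l z ->
    i = k /\ j = l;
  tile_label : forall S : {set 'I_n}, is_vertex T S -> forall k : 'I_n,
    k \in S <->
    exists s, shortest_walk T (0 : R[i]) s (pt R S) /\ (k, true) \in s }.

Definition standard_tiling n : tiles n :=
  fun i j => [set k : 'I_n | (i < k)%N && (k < j)%N]%SET.

(** * Networks *)

Inductive cell n :=
| Vertex of {set 'I_n}
| Face of {set 'I_n} & 'I_n & 'I_n.

Definition in_U n (T : tiles n) (c : cell n) : Prop :=
  match c with
  | Vertex X => is_vertex T X
  | Face X i j => (i < j)%N /\ X = T i j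
  end.

(* The values of the function outside U(T) are irrelevant. *)
Definition network (K : Type) n := (tiles n * (cell n -> K))%type.

Definition eq_on_U (K : Type) n (T : tiles n) (F G : cell n -> K) : Prop :=
  forall c, in_U T c -> F c = G c.

Definition sigma (K : pzRingType) n (S : {set 'I_n}) : K := (-1) ^+ (#|S|./2).

(* F_{A,T} is the restriction to U(T). *)
Definition mx_network (K : comNzRingType) n (A : 'M[K]_n) (c : cell n) : K :=
  match c with
  | Vertex X => sigma K X * minor A X X
  | Face X i j => sigma K (i |: X) *
      (if odd_ap X j i then minor A (j |: X) (i |: X)
       else minor A (i |: X) (j |: X))
  end.

(** * Cube moves *)

(* A cube move retiles a hexagon, so it turns tilings into tilings; the moves
   below are stated for arbitrary families of tiles and are only ever started
   from a tiling (see [generic_network]). *)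

Definition hexahedron (K : pzRingType)
    (a0 a1 a2 a3 a4 a5 a6 a7 a8 a9 b0 b1 b2 b3 : K) : Prop :=
  [/\ b1 * a1 * a0 = a1 * a2 * a3 + a7 * a8 * a9 + a0 * a4 * a7,
      b2 * a2 * a0 = a1 * a2 * a3 + a7 * a8 * a9 + a0 * a5 * a8,
      b3 * a3 * a0 = a1 * a2 * a3 + a7 * a8 * a9 + a0 * a6 * a9
    & b0 * a0 ^+ 2 * a1 * a2 * a3 =
      (a1 * a2 * a3) ^+ 2
      + a1 * a2 * a3 * (2 * a7 * a8 * a9 + a0 * a4 * a7 + a0 * a5 * a8
                        + a0 * a6 * a9)
      + (a8 * a9 + a0 * a4) * (a9 * a7 + a0 * a5) * (a7 * a8 + a0 * a6)].

(* The antipodal map of the cube exchanges a_k and a_k^* for k <= 3, and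
   a4/a7, a5/a8, a6/a9.  On nonzero values it preserves the relation. *)
Lemma hexahedron_antipode (K : fieldType)
    (a0 a1 a2 a3 a4 a5 a6 a7 a8 a9 b0 b1 b2 b3 : K) :
  a0 != 0 -> a1 != 0 -> a2 != 0 -> a3 != 0 ->
  hexahedron a0 a1 a2 a3 a4 a5 a6 a7 a8 a9 b0 b1 b2 b3 ->
  hexahedron b0 b1 b2 b3 a7 a8 a9 a4 a5 a6 a0 a1 a2 a3.
Proof.
move=> h0 h1 h2 h3 [e1 e2 e3 e4].
have solve (x y z : K) : y != 0 -> x * y = z -> x = z / y.
  by move=> y0 <-; rewrite mulfK.
move: e1; rewrite -mulrA => /solve -> ; last by rewrite mulf_neq0.
move: e2; rewrite -mulrA => /solve -> ; last by rewrite mulf_neq0.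
move: e3; rewrite -mulrA => /solve -> ; last by rewrite mulf_neq0.
move: e4; rewrite -!mulrA => /solve -> ; last by rewrite !mulf_neq0.
by split; field; rewrite ?h0 ?h1 ?h2 ?h3.
Qed.

Section CubeMoves.
Variables (K : pzRingType) (n : nat).
Implicit Types (T : tiles n) (F : cell n -> K) (S : {set 'I_n}) (p q r : 'I_n).

Definition hexagon_q T S p q r : Prop :=
  [/\ T p q = S, T q r = S & T p r = q |: S].

Definition hexagon_pr T S p q r : Prop :=
  [/\ T p r = S, T p q = r |: S & T q r = p |: S].

Definition same_other_tiles T T' p q r : Prop :=
  forall i j : 'I_n, (i < j)%N ->
    (i, j) \notin [:: (p, q); (p, r); (q, r)] -> T' i j = T i j.

Definition center_q S p q r (c : cell n) : Prop :=
  [\/ c = Vertex (q |: S), c = Face S p q, c = Face S q r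
    | c = Face (q |: S) p r].

Definition center_pr S p q r (c : cell n) : Prop :=
  [\/ c = Vertex (p |: (r |: S)), c = Face S p r, c = Face (r |: S) p q
    | c = Face (p |: S) q r].

(* The argument F carries a_0, ..., a_9, the argument F' the starred values. *)
Definition hexahedron_at F F' S p q r : Prop :=
  hexahedron
    (F (Vertex (q |: S))) (F (Face S p q)) (F (Face (q |: S) p r))
    (F (Face S q r)) (F (Vertex (p |: S))) (F (Vertex (p |: (q |: (r |: S)))))
    (F (Vertex (r |: S))) (F (Vertex (q |: (r |: S)))) (F (Vertex S))
    (F (Vertex (p |: (q |: S))))
    (F' (Vertex (p |: (r |: S)))) (F' (Face (r |: S) p q)) (F' (Face S p r))
    (F' (Face (p |: S) q r)).

Definition hexahedron_antipodal_at F F' S p q r : Prop :=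
  hexahedron
    (F' (Vertex (p |: (r |: S)))) (F' (Face (r |: S) p q)) (F' (Face S p r))
    (F' (Face (p |: S) q r)) (F (Vertex (q |: (r |: S)))) (F (Vertex S))
    (F (Vertex (p |: (q |: S)))) (F (Vertex (p |: S)))
    (F (Vertex (p |: (q |: (r |: S))))) (F (Vertex (r |: S)))
    (F (Vertex (q |: S))) (F (Face S p q)) (F (Face (q |: S) p r))
    (F (Face S q r)).

Definition cube_move_up (N N' : network K n) : Prop :=
  exists S p q r, (p < q < r)%N /\ [/\ p \notin S, q \notin S & r \notin S] /\
    [/\ hexagon_q N.1 S p q r, hexagon_pr N'.1 S p q r,
        same_other_tiles N.1 N'.1 p q r,
        hexahedron_at N.2 N'.2 S p q r
      & forall c, in_U N'.1 c -> ~ center_pr S p q r c -> N'.2 c = N.2 c].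

(* Read as equations for the unstarred values, the hexahedron relation has
   spurious solutions for arbitrary starred values, such as a_1 = 0 with
   a_0 = - a_8 a_9 / a_4 and a_2, a_3 given by their own equations.  The inverse
   of the upward move is the solution that also satisfies the antipodal form,
   which determines it when the starred values are nonzero. *)
Definition cube_move_down (N N' : network K n) : Prop :=
  exists S p q r, (p < q < r)%N /\ [/\ p \notin S, q \notin S & r \notin S] /\
    [/\ hexagon_pr N.1 S p q r, hexagon_q N'.1 S p q r,
        same_other_tiles N.1 N'.1 p q r,
        hexahedron_at N'.2 N.2 S p q r /\
        hexahedron_antipodal_at N'.2 N.2 S p q r
      & forall c, in_U N'.1 c -> ~ center_q S p q r c -> N'.2 c = N.2 c].

Definition rescaling (N N' : network K n) : Prop :=
  N'.1 = N.1 /\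
  exists2 a : K, a != 0 & forall c, in_U N.1 c -> N'.2 c = a * N.2 c.

Definition network_step (N N' : network K n) : Prop :=
  [\/ cube_move_up N N', cube_move_down N N' | rescaling N N'].

Definition net_equiv : network K n -> network K n -> Prop :=
  clos_refl_trans _ network_step.

End CubeMoves.

Definition generic_network (R : realType) n (N : network R[i] n) : Prop :=
  is_tiling R N.1 /\
  forall N' : network R[i] n, net_equiv N N' ->
    forall c, in_U N'.1 c -> N'.2 c != 0.

(* Main.v *)
Require Import Defs.
From Stdlib Require Import Relation_Operators.
From mathcomp Require Import all_boot all_order all_algebra.
From mathcomp Require Import complex ring zify lra.
From mathcomp Require Import all_classical all_reals all_analysis.
From mathcomp Require Import fintype finset.

Set Implicit Arguments.
Unset Strict Implicit.
Unset Printing Implicit Defensive.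
Import Order.TTheory GRing.Theory Num.Theory.
Import numFieldNormedType.Exports.
Local Open Scope ring_scope.

(** A network (T0, F) carries n^2 free values, as many as a matrix has entries, and
the theorem says that these values are coordinates on generic matrices which are
compatible with the cube moves.  Three facts carry it.

Minors satisfy the hexahedron relation ([mx_hexahedron]).  After division by
det A_S^S, each value on the cube [S, Spqr] is, up to sign, a minor of the 3 x 3
block of a Schur complement of A relative to S ([schur_minor], [schur_minor2],
[schur_minor3]); the relation becomes a polynomial identity in nine variables.
A cube move determines the new values from the old nonzero ones, so a network
equivalent to F_{A,T0} is a multiple of F_{A,T} for some T ([follows]), and its
values are nonzero when A is generic ([generic_equiv]).

The values on T0 determine A ([mx_network_inj]) and may be prescribed
([mx_network_surj]).  The entries (i, j) and (j, i) with |i - j| = d occur for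
the first time in the rhombus and the vertex spanned by i and j: the rhombus
value is affine in one of the two entries ([minor_entry]), and Sylvester's
identity ([minor_Sylvester]) then gives the other one.  The divisions are by
values of F on T0.

Every rhombus <S; i, j> occurs in a tiling reached from T0 by upward moves, so
genericity of the network forces all recorded minors of A to be nonzero
([generic_of_equiv]).  For a function u on the indices, the points
(k, u k - lam k^2) define a tiling: m belongs to the label of (i, j) when its
point lies above the line through the points i and j.  For large lam the points
are concave and the tiling is T0; as lam decreases, two tilings differ by a move
whenever three points become collinear ([sweep_flip]), that is, when lam is a
divided difference of u.  If these are distinct, one triple flips at a time
([sweep_reach]); a suitable u ends with the label S at (i, j) ([exists_sweep]).

It remains that T0 is a tiling ([standard_is_tiling]).  Its tiles and vertices
are sums of t_k e_k whose coefficients t are 1 on an interval and 0 outside it,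
up to the two end values, and a linear relation between the e_k has at least
two sign changes ([one_sign_change]).  Hence tiles do not overlap and vertices
have unique labels.  They cover the polygon because a representation of a point
with the least coefficient sum has this shape ([minimal_gap]). *)

(** * Bordered minors and Schur complements *)

Section Enum.
Variable n : nat.
Implicit Types (S : {set 'I_n}) (i j k : 'I_n).

(** The position of [i] in the increasing enumeration of [i |: S]. *)
Definition below i S : nat := #|[set k in S | (k < i)%N]%SET|.

Lemma sorted_enum_ord S : sorted (fun i j : 'I_n => i < j)%N (enum S).
Proof.
rewrite {1}/enum_mem -enumT.
apply: sorted_filter; first by move=> x y z; apply: ltn_trans.
by have := iota_ltn_sorted 0 n; rewrite -val_enum_ord sorted_map.
Qed.

Lemma enum_setU1 i S : i \notin S ->
  enum (i |: S) = [seq k : 'I_n <- enum S | (k < i)%N] ++ i :: [seq k : 'I_n <- enum S | (i < k)%N].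
Proof.
move=> iS.
have ltr : transitive ((fun i j : 'I_n => i < j)%N : rel 'I_n) by move=> x y z; apply: ltn_trans.
apply: (irr_sorted_eq ltr) => [x|||x]; first by rewrite /= ltnn.
- exact: sorted_enum_ord.
- rewrite (sorted_pairwise ltr) pairwise_cat pairwise_cons /=.
  have pw P : pairwise (fun i j : 'I_n => i < j)%N [seq k : 'I_n <- enum S | P k].
    rewrite -(sorted_pairwise ltr); apply: sorted_filter => //.
    exact: sorted_enum_ord.
  rewrite !pw !andbT; apply/andP; split.
    apply/allrelP => x y; rewrite mem_filter => /andP[xi _].
    rewrite inE => /orP[/eqP -> //|]; rewrite mem_filter => /andP[iy _] /=.
    exact: ltn_trans iy.
  by apply/allP => y; rewrite mem_filter => /andP[].
- rewrite mem_cat !(inE, mem_filter, mem_enum).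
  by rewrite -val_eqE -enumT mem_enum /=; case: ltngtP; rewrite ?andbT ?orbF.
Qed.

Lemma belowE i S : below i S = size [seq k : 'I_n <- enum S | (k < i)%N].
Proof.
rewrite /below cardE; congr (size _); rewrite /enum_mem -filter_predI.
by apply: eq_filter => k; rewrite /= !inE andbC.
Qed.

Lemma nth_enum_setU1 x0 i S a : i \notin S ->
  nth x0 (enum (i |: S)) (bump (below i S) a) = nth x0 (enum S) a.
Proof.
move=> iS; set s := enum S; have -> : s =
    [seq k : 'I_n <- s | (k < i)%N] ++ [seq k : 'I_n <- s | (i < k)%N].
  transitivity [seq k : 'I_n <- enum (i |: S) | k != i].
    rewrite /s /enum_mem -filter_predI; apply: eq_filter => k /=; rewrite !inE.
    by case: eqVneq => //= ->; rewrite (negbTE iS).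
  rewrite enum_setU1 // filter_cat /= eqxx -!filter_predI.
  by congr (_ ++ _); apply: eq_filter => k /=; rewrite -val_eqE /=; case: ltngtP.
rewrite enum_setU1 // belowE -/s; set s1 := [seq k : 'I_n <- s | (k < i)%N].
set s2 := [seq k : 'I_n <- s | (i < k)%N].
rewrite /bump !nth_cat; case: (leqP (size s1) a) => le; last by rewrite add0n le.
by rewrite -[(true + a)%N]/a.+1 ltnNge leqW //= subSn.
Qed.

Lemma nth_enum_below x0 i S : i \notin S -> nth x0 (enum (i |: S)) (below i S) = i.
Proof. by move=> iS; rewrite enum_setU1 // belowE nth_cat ltnn subnn. Qed.

Lemma below_le i S : (below i S <= #|S|)%N.
Proof. by apply/subset_leq_card/subsetP => k; rewrite inE => /andP[]. Qed.

Lemma belowU1 i k S : k \notin S -> below i (k |: S) = ((k < i) + below i S)%N.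
Proof.
move=> kS; rewrite /below; case: ltnP => ki.
  have -> : [set m in k |: S | (m < i)%N] = k |: [set m in S | (m < i)%N].
    by apply/setP => m; rewrite !inE; case: eqVneq => // ->; rewrite ki.
  by rewrite cardsU1 inE (negbTE kS).
congr #|pred_of_set _|; apply/setP => m; rewrite !inE; case: eqVneq => // ->.
by rewrite (negbTE kS) ltnNge ki.
Qed.

End Enum.

Section Minors.
Variables (K : fieldType) (n : nat).
Implicit Types (A : 'M[K]_n) (X Y S : {set 'I_n}) (i j k : 'I_n).

(** Reading rows and columns from lists makes the size a free parameter, which
removes the cast from [minor]. *)
Lemma minor_enum A X Y m x0 : #|X| = m -> #|Y| = m ->
  minor A X Y = \det (\matrix_(a < m, b < m) A (nth x0 (enum X) a) (nth x0 (enum Y) b)).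
Proof.
move=> <- eY; rewrite /minor; congr (\det _); apply/matrixP => a b.
rewrite /conform_mx; case: eqP => // e1; case: eqP => [e2|]; last by rewrite eY.
by rewrite castmxE !mxE !(enum_val_nth x0).
Qed.

Lemma eq_minor A A' X Y : (forall x y, x \in X -> y \in Y -> A x y = A' x y) ->
  minor A X Y = minor A' X Y.
Proof.
move=> eA; rewrite /minor; congr (\det _); congr conform_mx.
by apply/matrixP => a b; rewrite !mxE eA // enum_valP.
Qed.

Lemma minor0 A : minor A set0 set0 = 1.
Proof.
rewrite /minor conform_mx_id; move: (mxsub _ _ _); rewrite cards0 => M.
exact: det_mx00.
Qed.

(** The cofactor sign of row [i] and column [j] in the submatrix with rows
[i |: S] and columns [j |: S]. *)
Definition border_sign i j S : K := (-1) ^+ (below i S + below j S).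

Lemma border_signC i j S : border_sign i j S = border_sign j i S.
Proof. by rewrite /border_sign addnC. Qed.

Lemma border_sign_diag i S : border_sign i i S = 1.
Proof. by rewrite /border_sign exprD -expr2 sqrr_sign. Qed.

Lemma border_sign_sqr i j S : border_sign i j S * border_sign i j S = 1.
Proof. by rewrite -expr2 sqrr_sign. Qed.

(** Subtracting a combination of the rows in [S] from row [i] does not change the
minor.  If the new row vanishes on [S], its expansion has one term, and the
cofactor is the minor on [S]. *)
Lemma minor_border A S i j (c r : 'I_n -> K) : i \notin S -> j \notin S ->
    (forall l, r l = A i l - \sum_(k in S) c k * A k l) ->
    (forall l, l \in S -> r l = 0) ->
  minor A (i |: S) (j |: S) = border_sign i j S * r j * minor A S S.
Proof.
move=> iS jS rE r0.
have cU k : k \notin S -> #|k |: S| = #|S|.+1 by move=> kS; rewrite cardsU1 kS.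
rewrite (minor_enum A i (cU i iS) (cU j jS)) (minor_enum A i (erefl #|S|) (erefl _)).
set M := (X in \det X = _); set N := (X in _ * \det X).
pose a0 : 'I_#|S|.+1 := inord (below i S); pose b0 : 'I_#|S|.+1 := inord (below j S).
have a0E : a0 = below i S :> nat by rewrite inordK // ltnS below_le.
have b0E : b0 = below j S :> nat by rewrite inordK // ltnS below_le.
pose eS (k : nat) := nth i (enum S) k.
(* Row [a0] is row [i] of [A]; pairing row [b] with the cofactors of row [a0]
   gives zero for the other rows. *)
have adjE b : \sum_l M b l * \adj M l a0 = (\det M) *+ (b == a0).
  by have /matrixP/(_ b a0) := mul_mx_adj M; rewrite !mxE.
have M0 l : M a0 l = A i (nth i (enum (j |: S)) l).
  by rewrite mxE a0E nth_enum_below.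
have ML a l : M (lift a0 a) l = A (eS a) (nth i (enum (j |: S)) l).
  by rewrite mxE /= a0E nth_enum_setU1.
have sumS (f : 'I_n -> K) : \sum_(k in S) f k = \sum_(a < #|S|) f (eS a).
  rewrite big_enum_val /=; apply: eq_bigr => a _.
  by rewrite /eS (enum_val_nth i).
have -> : \det M = \sum_(l < #|S|.+1) r (nth i (enum (j |: S)) l) * \adj M l a0.
  transitivity (\sum_(l < #|S|.+1) (M a0 l * \adj M l a0 -
     \sum_(a < #|S|) c (eS a) * (M (lift a0 a) l * \adj M l a0))).
    rewrite big_split /= adjE eqxx sumrN exchange_big /= [X in _ - X]big1 ?subr0 //.
    by move=> a _; rewrite -big_distrr /= adjE eq_sym (negbTE (neq_lift _ _)) mulr0.
  apply: eq_bigr => l _; rewrite rE mulrBl -M0; congr (_ - _).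
  rewrite sumS big_distrl /=; apply: eq_bigr => a _.
  by rewrite -ML mulrA.
rewrite (bigD1 b0) //= big1 ?addr0 => [|l lb]; last first.
  rewrite r0 ?mul0r //; have [k -> |e] := unliftP b0 l; last by rewrite e eqxx in lb.
  by rewrite /= b0E nth_enum_setU1 // -mem_enum mem_nth // -cardE.
rewrite b0E nth_enum_below // mxE /cofactor a0E b0E mulrCA -/(border_sign i j S) !mulrA.
congr (_ * _); congr (\det _); apply/matrixP => a b.
by rewrite !mxE /= a0E b0E !nth_enum_setU1.
Qed.

(** [B] lists the rows of [A] after the columns in [S] have been cleared by rows in
[S].  The coefficients stay existential, so that pivots can be added without
inverting matrices. *)
Definition schur A S (B : 'I_n -> 'I_n -> K) : Prop :=
  (forall i, exists c : 'I_n -> K, forall l, B i l = A i l - \sum_(k in S) c k * A k l) /\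
  (forall i l, l \in S -> B i l = 0).

Lemma schur_minor A S B i j : schur A S B -> i \notin S -> j \notin S ->
  minor A (i |: S) (j |: S) = border_sign i j S * B i j * minor A S S.
Proof. by move=> [/(_ i)[c rE] r0] iS jS; apply: (minor_border iS jS rE (r0 i)). Qed.

Lemma schur_exists A S : minor A S S != 0 -> exists B, schur A S B.
Proof.
move=> D0; pose N : 'M[K]_(#|S|, #|S|) := mxsub enum_val enum_val A.
have Nu : N \in unitmx by rewrite unitmxE unitfE; move: D0; rewrite /minor conform_mx_id.
pose w i : 'M[K]_(1, #|S|) := (\row_b A i (enum_val b)) *m invmx N.
(* The coefficients, indexed by the rank of [k] in [S], as a function of [k]. *)
pose c i k : K := \sum_a w i 0 a *+ (enum_val a == k).
pose B i l := A i l - \sum_(k in S) c i k * A k l.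
exists B; split => [i|i l lS]; first by exists (c i).
apply/eqP; rewrite subr_eq0; apply/eqP.
have -> : \sum_(k in S) c i k * A k l = \sum_a w i 0 a * A (enum_val a) l.
  under eq_bigr do rewrite /c big_distrl /=.
  rewrite exchange_big /=; apply: eq_bigr => a _.
  rewrite (bigD1 (enum_val a)) ?enum_valP //= eqxx big1 ?addr0 // => k /andP[_].
  by rewrite eq_sym => /negbTE ->; rewrite mul0r.
have : (w i *m N) 0 (enum_rank_in lS l) = A i l.
  by rewrite mulmxKV // mxE enum_rankK_in.
by rewrite mxE => <-; apply: eq_bigr => a _; rewrite [N _ _]mxE enum_rankK_in.
Qed.

(** One step of Gaussian elimination. *)
Lemma schur_pivot A S B k : schur A S B -> k \notin S -> B k k != 0 ->
  schur A (k |: S) (fun i l => B i l - B i k / B k k * B k l).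
Proof.
move=> [rE r0] kS Bk; split=> [i|i l]; last first.
  rewrite !inE => /predU1P[->|lS]; first by rewrite divfK ?subrr.
  by rewrite (r0 i l lS) (r0 k l lS) mulr0 subrr.
have [ci ciE] := rE i; have [ck ckE] := rE k.
set q := B i k / B k k.
exists (fun m => if m == k then q else ci m - q * ck m) => l.
rewrite big_setU1 //= eqxx ciE ckE.
have -> : \sum_(m in S) (if m == k then q else ci m - q * ck m) * A m l =
  \sum_(m in S) ci m * A m l - q * \sum_(m in S) ck m * A m l.
  rewrite big_distrr /= -sumrB; apply: eq_bigr => m mS.
  have -> : (m == k) = false by apply: contraNF kS => /eqP <-.
  by rewrite mulrBl mulrA.
by ring.
Qed.

End Minors.

Section Sylvester.
Variables (K : fieldType) (n : nat).
Implicit Types (A : 'M[K]_n) (S : {set 'I_n}) (i j k p q r : 'I_n).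

Lemma odd_apE S i j : i != j -> odd_ap S i j = (j < i)%N (+) odd #|S|.
Proof.
rewrite /odd_ap -signr_odd -val_eqE /= => ij.
have pos : (0 < (i : nat)%:Z - (j : nat)%:Z) = (j < i)%N by rewrite subr_gt0.
case: (odd _); last by rewrite expr0 mulr1 pos addbF.
rewrite expr1 mulrN1 oppr_gt0 subr_lt0 addbT ltz_nat.
by rewrite -leqNgt ltn_neqAle ij.
Qed.

(** The odd one of the two almost-principal minors, selected by the parity of [S]. *)
Lemma mx_network_face A S i j : (i < j)%N ->
  mx_network A (Face S i j) = sigma K (i |: S) *
    (if odd #|S| then minor A (i |: S) (j |: S) else minor A (j |: S) (i |: S)).
Proof.
move=> ij; rewrite /= odd_apE -?val_eqE ?gtn_eqF //= ij addTb.
by case: (odd _).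
Qed.

Lemma schur_minor2 A S B i j k : schur A S B -> k \notin S -> B k k != 0 ->
  i \notin k |: S -> j \notin k |: S ->
  minor A (i |: (k |: S)) (j |: (k |: S)) =
    border_sign K i j (k |: S) * (B i j * B k k - B i k * B k j) * minor A S S.
Proof.
move=> sB kS Bk iS jS; rewrite (schur_minor (schur_pivot sB kS Bk)) //.
rewrite (schur_minor sB) // border_sign_diag mul1r -!mulrA; congr (_ * _).
by rewrite !mulrA mulrBl mulrAC divfK.
Qed.

(** Both sides are a 2 x 2 minor of the Schur complement; the two border signs of
the off-diagonal product are equal and cancel. *)
Lemma minor_Sylvester A S i j : i \notin S -> j \notin S -> i != j ->
    minor A S S != 0 -> minor A (i |: S) (i |: S) != 0 ->
  minor A (j |: (i |: S)) (j |: (i |: S)) * minor A S S =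
  minor A (i |: S) (i |: S) * minor A (j |: S) (j |: S)
  - minor A (i |: S) (j |: S) * minor A (j |: S) (i |: S).
Proof.
move=> iS jS ij D0; have [B sB] := schur_exists D0.
rewrite !(schur_minor sB) // !border_sign_diag !mul1r mulf_eq0 => /norP[Bi _].
rewrite (schur_minor2 sB) // ?inE ?negb_or 1?eq_sym ?ij // border_sign_diag.
rewrite [border_sign K j i S]border_signC; set s := border_sign K i j S.
rewrite (_ : s * B i j * _ * (s * B j i * _) =
   (s * s) * (B i j * minor A S S * B j i * minor A S S)); last by ring.
by rewrite border_sign_sqr; ring.
Qed.

Lemma schur_minor3 A S B p q r : schur A S B ->
    p \notin S -> q \notin S -> r \notin S -> p != q -> p != r -> q != r ->
    B q q != 0 -> minor A (p |: (q |: S)) (p |: (q |: S)) != 0 ->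
  minor A (r |: (p |: (q |: S))) (r |: (p |: (q |: S))) =
   (B p p * B q q * B r r + B p q * B q r * B r p + B p r * B q p * B r q
    - B p p * B q r * B r q - B q q * B p r * B r p - B r r * B p q * B q p)
   * minor A S S.
Proof.
move=> sB pS qS rS pq pr qr Bq.
have sB1 := schur_pivot sB qS Bq.
have pS1 : p \notin q |: S by rewrite !inE negb_or pq.
have rS1 : r \notin q |: S by rewrite !inE negb_or eq_sym qr.
have rS2 : r \notin p |: (q |: S) by rewrite !inE !negb_or eq_sym pr eq_sym qr.
rewrite {1}(schur_minor sB1) // border_sign_diag mul1r !mulf_eq0 => /norP[Bp _].
rewrite (schur_minor2 sB1) // (schur_minor sB) // !border_sign_diag.
by field.
Qed.

(** A bordered minor is affine in its corner entry, and the coefficient is the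
minor on [S] up to sign. *)
Lemma minor_entry A A' S i j : i \notin S -> j \notin S ->
    (forall x y, x \in i |: S -> y \in j |: S -> (x, y) != (i, j) -> A' x y = A x y) ->
  minor A S S != 0 ->
  minor A' (i |: S) (j |: S) =
  minor A (i |: S) (j |: S) + border_sign K i j S * (A' i j - A i j) * minor A S S.
Proof.
move=> iS jS eA D0.
have ne m x : m \notin S -> x \in S -> (x == m) = false.
  by move=> mS; apply: contraTF => /eqP ->.
have eSr x y : x \in S -> y \in j |: S -> A' x y = A x y.
  by move=> xS yS; rewrite eA // ?inE ?xS ?orbT // xpair_eqE ne.
have D0' : minor A' S S = minor A S S.
  by apply: eq_minor => x y xS yS; rewrite eSr // inE yS orbT.
have [B [/(_ i)[c cE] r0]] := schur_exists D0.
rewrite (minor_border iS jS cE (r0 i)).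
pose r l := A' i l - \sum_(k in S) c k * A' k l.
have Ac l : l \in j |: S -> \sum_(k in S) c k * A' k l = \sum_(k in S) c k * A k l.
  by move=> lS; apply: eq_bigr => k kS; rewrite eSr.
have r0' l : l \in S -> r l = 0.
  move=> lS; have lS1 : l \in j |: S by rewrite inE lS orbT.
  by rewrite /r Ac // eA ?inE ?eqxx // ?xpair_eqE ?eqxx ?ne // -cE r0.
rewrite (minor_border (r := r) iS jS (fun=> erefl) r0') D0' /r Ac ?inE ?eqxx // cE.
by ring.
Qed.

End Sylvester.

(** * The hexahedron relation for minors *)

Section Hexahedron.
Variables (K : fieldType) (n : nat).
Implicit Types (A : 'M[K]_n) (S : {set 'I_n}) (i j k p q r : 'I_n).

(** The four relations are homogeneous, of degrees 3, 3, 3 and 6. *)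
Lemma hexahedron_scale (c a0 a1 a2 a3 a4 a5 a6 a7 a8 a9 b0 b1 b2 b3 : K) :
  hexahedron a0 a1 a2 a3 a4 a5 a6 a7 a8 a9 b0 b1 b2 b3 ->
  hexahedron (c * a0) (c * a1) (c * a2) (c * a3) (c * a4) (c * a5) (c * a6)
    (c * a7) (c * a8) (c * a9) (c * b0) (c * b1) (c * b2) (c * b3).
Proof.
move=> [e1 e2 e3 e4]; split.
- by transitivity (c ^+ 3 * (b1 * a1 * a0)); [ring | rewrite e1; ring].
- by transitivity (c ^+ 3 * (b2 * a2 * a0)); [ring | rewrite e2; ring].
- by transitivity (c ^+ 3 * (b3 * a3 * a0)); [ring | rewrite e3; ring].
- by transitivity (c ^+ 6 * (b0 * a0 ^+ 2 * a1 * a2 * a3)); [ring | rewrite e4; ring].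
Qed.

(** The sign changes that border signs produce: each sign occurs an even number
of times in every monomial. *)
Lemma hexahedron_sign (u v w a0 a1 a2 a3 a4 a5 a6 a7 a8 a9 b0 b1 b2 b3 : K) :
  u * u = 1 -> v * v = 1 -> w = u * v ->
  hexahedron a0 a1 a2 a3 a4 a5 a6 a7 a8 a9 b0 b1 b2 b3 ->
  hexahedron a0 (u * a1) (w * a2) (v * a3) a4 a5 a6 a7 a8 a9
    b0 (u * b1) (w * b2) (v * b3).
Proof.
move=> uu vv -> [e1 e2 e3 e4].
have P : u * a1 * (u * v * a2) * (v * a3) = a1 * a2 * a3.
  by transitivity ((u * u) * (v * v) * (a1 * a2 * a3)); [ring | rewrite uu vv !mul1r].
split; rewrite P.
- by rewrite -e1; transitivity ((u * u) * (b1 * a1 * a0)); [ring | rewrite uu mul1r].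
- rewrite -e2; transitivity ((u * u) * (v * v) * (b2 * a2 * a0)); first by ring.
  by rewrite uu vv !mul1r.
- by rewrite -e3; transitivity ((v * v) * (b3 * a3 * a0)); [ring | rewrite vv mul1r].
- rewrite -e4; transitivity (b0 * a0 ^+ 2 * (u * a1 * (u * v * a2) * (v * a3))).
    by ring.
  by rewrite P; ring.
Qed.

(** Dividing by the minor on [S] leaves the 3 x 3 block of a Schur complement
[B].  The five nonvanishing minors are those needed as pivots. *)
Lemma mx_hexahedron A S p q r : (p < q < r)%N ->
    [/\ p \notin S, q \notin S & r \notin S] ->
    minor A S S != 0 -> minor A (p |: S) (p |: S) != 0 ->
    minor A (q |: S) (q |: S) != 0 -> minor A (r |: S) (r |: S) != 0 ->
    minor A (p |: (q |: S)) (p |: (q |: S)) != 0 ->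
  hexahedron_at (mx_network A) (mx_network A) S p q r.
Proof.
move=> /andP[pq qr] [pS qS rS] D0.
have pr := ltn_trans pq qr.
have npq : p != q by rewrite -val_eqE ltn_eqF.
have npr : p != r by rewrite -val_eqE ltn_eqF.
have nqr : q != r by rewrite -val_eqE ltn_eqF.
have [B sB] := schur_exists D0.
rewrite !(schur_minor sB) // !border_sign_diag !mul1r !mulf_eq0 (negbTE D0) !orbF.
move=> Bp Bq Br Dpq.
have qpS : q \notin p |: S by rewrite !inE negb_or eq_sym npq.
have rpS : r \notin p |: S by rewrite !inE negb_or eq_sym npr.
have pqS : p \notin q |: S by rewrite !inE negb_or npq.
have rqS : r \notin q |: S by rewrite !inE negb_or eq_sym nqr.
have prS : p \notin r |: S by rewrite !inE negb_or npr.
have qrS : q \notin r |: S by rewrite !inE negb_or nqr.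
have rpqS : r \notin p |: (q |: S) by rewrite !inE !negb_or eq_sym npr eq_sym nqr.
rewrite /hexahedron_at !mx_network_face //= /sigma.
rewrite (_ : p |: (q |: (r |: S)) = r |: (p |: (q |: S))); last first.
  by rewrite ![r |: (_ |: _)]setUCA.
rewrite (schur_minor3 sB) // !(schur_minor2 sB) // !(schur_minor sB) //.
rewrite !cardsU1 pS qS rS rpqS pqS qpS prS qrS /= !border_sign_diag /border_sign.
have [qp rq rp] : [/\ (q < p)%N = false, (r < q)%N = false & (r < p)%N = false].
  by split; apply/negbTE; rewrite -leqNgt ltnW.
rewrite !belowU1 // pq qr pr qp rq rp !add0n uphalf_half.
set D := minor A S S; set e := (#|S|./2).
set tp := below p S; set tq := below q S; set tr := below r S.
have tt m : (-1) ^+ m * (-1) ^+ m = 1 :> K by rewrite -expr2 sqrr_sign.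
have uu a b : ((-1) ^+ a * (-1) ^+ b) * ((-1) ^+ a * (-1) ^+ b) = 1 :> K.
  by rewrite mulrACA !tt mulr1.
have ww : (-1) ^+ tp * (-1) ^+ tr = ((-1) ^+ tp * (-1) ^+ tq) * ((-1) ^+ tq * (-1) ^+ tr) :> K.
  by rewrite mulrA -[_ * _ * (-1) ^+ tq]mulrA tt mulr1.
have H a0 a1 a2 a3 a4 a5 a6 a7 a8 a9 b0 b1 b2 b3 :=
   @hexahedron_sign _ _ _ a0 a1 a2 a3 a4 a5 a6 a7 a8 a9 b0 b1 b2 b3
   (uu tp tq) (uu tq tr) ww.
have H' a0 a1 a2 a3 a4 a5 a6 a7 a8 a9 b0 b1 b2 b3 E :=
   hexahedron_scale ((-1) ^+ e * D) (@H a0 a1 a2 a3 a4 a5 a6 a7 a8 a9 b0 b1 b2 b3 E).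
(* The parity of [S] decides which of [B p q], [B q p] is recorded; an odd [S]
   transposes [B] and shifts the signs [sigma]. *)
rewrite {H}; case: (odd _) => /=; rewrite ?add0n ?add1n !exprD ?expr1 ?expr0 !exprS.
- have := H' (- B q q) (- B p q) (B r p * B q q - B r q * B q p) (- B q r)
    (- B p p) (B p p * B q q * B r r + B p q * B q r * B r p + B p r * B q p * B r q
      - B p p * B q r * B r q - B q q * B p r * B r p - B r r * B p q * B q p)
    (- B r r) (- (B q q * B r r - B q r * B r q)) 1
    (- (B p p * B q q - B p q * B q p)) (- (B p p * B r r - B p r * B r p))
    (- (B q p * B r r - B q r * B r p)) (- B p r)
    (- (B r q * B p p - B r p * B p q)).
  rewrite -/D; match goal with |- (_ -> ?P) -> ?Q => have -> : P = Q by congr hexahedron; ring end.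
  by apply; split; ring.
- have := H' (B q q) (B q p) (B p r * B q q - B p q * B q r) (B r q)
    (B p p) (- (B p p * B q q * B r r + B p q * B q r * B r p + B p r * B q p * B r q
      - B p p * B q r * B r q - B q q * B p r * B r p - B r r * B p q * B q p))
    (B r r) (- (B q q * B r r - B q r * B r q)) 1
    (- (B p p * B q q - B p q * B q p)) (- (B p p * B r r - B p r * B r p))
    (- (B p q * B r r - B p r * B r q)) (B r p)
    (- (B q r * B p p - B q p * B p r)).
  rewrite -/D; match goal with |- (_ -> ?P) -> ?Q => have -> : P = Q by congr hexahedron; ring end.
  by apply; split; ring.
Qed.
End Hexahedron.

(** * Recovering a matrix from the standard tiling *)

Section Intervals.
Variable n : nat.
Implicit Types (S X : {set 'I_n}) (i j k : 'I_n) (a b : nat).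

Definition itv a b : {set 'I_n} := [set k : 'I_n | (a <= k < b)%N]%SET.

Lemma standard_itv i j : standard_tiling i j = itv i.+1 j.
Proof. by apply/setP => k; rewrite !inE. Qed.

Lemma itv_consl i b : (i < b)%N -> itv i b = i |: itv i.+1 b.
Proof. by move=> ib; apply/setP => k; rewrite !inE -val_eqE /=; lia. Qed.

Lemma itv_consr a j : (a <= j)%N -> itv a j.+1 = j |: itv a j.
Proof. by move=> ib; apply/setP => k; rewrite !inE -val_eqE /=; lia. Qed.

Lemma itv_empty a b : (b <= a)%N -> itv a b = set0.
Proof. by move=> ib; apply/setP => k; rewrite !inE; lia. Qed.

Lemma itv_minn a b : itv a b = itv a (minn b n).
Proof. by apply/setP => k; rewrite !inE; have := ltn_ord k; lia. Qed.

Lemma vertex_standard X : (1 < n)%N ->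
  is_vertex (@standard_tiling n) X <-> exists a b, X = itv a b.
Proof.
move=> n1; split=> [[i [j [ij]]]|[a [b ->]]].
  rewrite !standard_itv -itv_consr // -!itv_consl //; last exact: ltnW.
  by rewrite !inE => /or4P[]/eqP ->; do 2 eexists.
rewrite itv_minn; move: (minn b n) (geq_minr b n) => {}b bn.
have mk (i j : nat) : (i < j < n)%N -> exists i' j' : 'I_n, i' = i :> nat /\ j' = j :> nat.
  move=> /andP[ij jn]; have i_n := ltn_trans ij jn.
  by exists (Ordinal i_n), (Ordinal jn).
case: (ltngtP b a.+1) => [ba|ab|ba].
- have [i [j [i0 j1]]] := mk 0 1 n1.
  exists i, j; split; first by rewrite i0 j1.
  by rewrite standard_itv !inE [itv a b]itv_empty // [itv i.+1 j]itv_empty ?i0 ?j1 // eqxx.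
- have [|i [j [ia jb]]] := mk a b.-1; first by lia.
  exists i, j; split; first by lia.
  rewrite standard_itv -itv_consr; last by lia.
  rewrite -!itv_consl; [|lia|lia].
  by rewrite !inE (_ : j.+1 = b) ?ia ?eqxx ?orbT //; lia.
- case: (ltnP b n) => [bn'|nb].
    have [|i [j [ia jb]]] := mk a a.+1; first by lia.
    exists i, j; split; first by lia.
    rewrite standard_itv -itv_consl; last by lia.
    by rewrite !inE ia jb ba eqxx ?orbT.
  have [|i [j [ia jb]]] := mk a.-1 a; first by lia.
  exists i, j; split; first by lia.
  rewrite standard_itv -itv_consr; last by lia.
  by rewrite !inE (_ : i.+1 = a) ?jb ?ba ?eqxx ?orbT //; lia.
Qed.

Definition between i j := standard_tiling i j :|: standard_tiling j i.

Lemma betweenC i j : between i j = between j i.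
Proof. exact: setUC. Qed.

Lemma between_lt i j : (i < j)%N -> between i j = itv i.+1 j.
Proof. by move=> ij; apply/setP => k; rewrite !inE; lia. Qed.

Lemma between_notinl i j : i \notin between i j.
Proof. by rewrite !inE; lia. Qed.

Lemma between_notinr i j : j \notin between i j.
Proof. by rewrite !inE; lia. Qed.

End Intervals.

(** Truncated subtraction makes one of the two terms vanish. *)
Definition index_dist (i j : nat) := ((i - j) + (j - i))%N.

Section Reconstruction.
Variables (K : fieldType) (n : nat).
Hypothesis n1 : (1 < n)%N.
Implicit Types (A : 'M[K]_n) (S : {set 'I_n}) (i j k : 'I_n).
Let T0 := @standard_tiling n.

Lemma sigma_sqr S : sigma K S * sigma K S = 1.
Proof. by rewrite -expr2 sqrr_sign. Qed.

Lemma sigma_neq0 S : sigma K S != 0.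
Proof. by rewrite signr_eq0. Qed.

Lemma minor_set1 A i : minor A [set i] [set i] = A i i.
Proof.
have := @minor_border _ _ A set0 i i (fun=> 0) (A i).
rewrite setU0 border_sign_diag minor0 mulr1 mul1r.
by apply; rewrite ?inE // => l; rewrite ?inE // big_set0 subr0.
Qed.

Lemma in_U_itv a b : in_U T0 (Vertex (itv n a b)).
Proof. by apply/(vertex_standard _ n1); exists a, b. Qed.

(** Induction on the distance of an entry to the diagonal. *)
Lemma mx_network_inj A A' :
  (forall c, in_U T0 c -> mx_network A c != 0) ->
  eq_on_U T0 (mx_network A) (mx_network A') -> A = A'.
Proof.
move=> nz eAA.
have V a b : minor A (itv n a b) (itv n a b) = minor A' (itv n a b) (itv n a b).
  by apply: (mulfI (sigma_neq0 (itv n a b))); apply: (eAA _ (in_U_itv a b)).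
have V0 a b : minor A (itv n a b) (itv n a b) != 0.
  by have := nz _ (in_U_itv a b); rewrite /= mulf_eq0 negb_or => /andP[].
suff main d i j : (i <= j)%N -> (j - i = d)%N -> A i j = A' i j /\ A j i = A' j i.
  apply/matrixP => i j; case: (leqP i j) => ij.
    by have [] := main _ i j ij erefl.
  by have [] := main _ j i (ltnW ij) erefl.
elim/ltn_ind: d i j => d IH i j ij dE.
have IH' (x y : 'I_n) : (index_dist x y < d)%N -> A x y = A' x y.
  rewrite /index_dist => xyd; case: (leqP x y) => xy.
    have lt : (y - x < d)%N by lia.
    by have [] := IH _ lt x y xy erefl.
  have lt : (x - y < d)%N by lia.
  by have [] := IH _ lt y x (ltnW xy) erefl.
case: (eqVneq i j) => [<-|nij].
  by have := V i i.+1; rewrite itv_consr // itv_empty // setU0 !minor_set1.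
have {}ij : (i < j)%N by rewrite ltn_neqAle ij andbT.
set S := itv n i.+1 j.
have iS : i \notin S by rewrite !inE; lia.
have jS : j \notin S by rewrite !inE; lia.
have D0 : minor A S S != 0 by exact: V0.
have Eij : minor A' (i |: S) (j |: S) =
    minor A (i |: S) (j |: S) + border_sign K i j S * (A' i j - A i j) * minor A S S.
  apply: minor_entry => // x y; rewrite !inE xpair_eqE -!val_eqE /= => xS yS xy.
  by rewrite IH' //; move: xS yS xy; rewrite /index_dist; lia.
have Eji : minor A' (j |: S) (i |: S) =
    minor A (j |: S) (i |: S) + border_sign K j i S * (A' j i - A j i) * minor A S S.
  apply: minor_entry => // x y; rewrite !inE xpair_eqE -!val_eqE /= => xS yS xy.
  by rewrite IH' //; move: xS yS xy; rewrite /index_dist; lia.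
have back x y : minor A' (x |: S) (y |: S) =
    minor A (x |: S) (y |: S) + border_sign K x y S * (A' x y - A x y) * minor A S S ->
    minor A (x |: S) (y |: S) = minor A' (x |: S) (y |: S) -> A x y = A' x y.
  move=> -> /eqP; rewrite -subr_eq0 opprD addNKr oppr_eq0 !mulf_eq0.
  by rewrite (negbTE D0) signr_eq0 orbF subr_eq0 => /eqP.
have iI : i |: S = itv n i j by rewrite -itv_consl.
have jI : j |: S = itv n i.+1 j.+1 by rewrite -itv_consr.
have ijI : j |: (i |: S) = itv n i j.+1 by rewrite iI -itv_consr // ltnW.
have Syl (B : 'M[K]_n) : minor B S S != 0 -> minor B (i |: S) (i |: S) != 0 ->
   minor B (i |: S) (j |: S) * minor B (j |: S) (i |: S) =
   minor B (i |: S) (i |: S) * minor B (j |: S) (j |: S) -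
   minor B (j |: (i |: S)) (j |: (i |: S)) * minor B S S.
  by move=> ? ?; rewrite minor_Sylvester // opprB addrC subrK.
(* The face gives one factor of this product, hence also the other one. *)
have prodE : minor A (i |: S) (j |: S) * minor A (j |: S) (i |: S) =
  minor A' (i |: S) (j |: S) * minor A' (j |: S) (i |: S).
  rewrite !Syl ?ijI ?iI ?jI ?V //; rewrite -?V //; exact: V0.
have Uf : in_U T0 (Face S i j) by rewrite /= /T0 standard_itv.
have := eAA _ Uf; have := nz _ Uf; rewrite !mx_network_face // mulf_eq0 negb_or.
move=> /andP[_ f0] /(mulfI (sigma_neq0 _)).
move: f0; case: (odd _) => f0 fE.
  split; apply: back => //; apply: (mulfI f0); by rewrite prodE fE.
split; apply: back => //; apply: (mulIf f0); by rewrite prodE fE.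
Qed.

(** The matrix is built diagonal by diagonal; each stage matches the values that
only involve entries within the given distance. *)
Lemma mx_network_surj (F : cell n -> K) :
  F (Vertex set0) = 1 -> (forall c, in_U T0 c -> F c != 0) ->
  exists A, eq_on_U T0 (mx_network A) F.
Proof.
move=> F0 nz.
pose correct_upto d A := (forall i j, (i < j)%N -> (j - i < d)%N ->
    mx_network A (Face (standard_tiling i j) i j) = F (Face (standard_tiling i j) i j)) /\
  (forall a b, (b <= n)%N -> (b - a <= d)%N ->
    mx_network A (Vertex (itv n a b)) = F (Vertex (itv n a b))).
suff main d : exists A, correct_upto d.+1 A.
  have [A [gF gV]] := main n; exists A => -[X|X i j] /=.
    move/(vertex_standard _ n1) => [a [b ->]]; rewrite itv_minn.
    by apply: gV; [exact: geq_minr | have := geq_minr b n; lia].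
  by move=> [ij ->]; apply: gF => //; have := ltn_ord j; lia.
elim: d => [|d [A [gF gV]]].
  exists (\matrix_(i, j) if i == j then F (Vertex [set i]) else 0); split.
    by move=> i j; lia.
  move=> a b bn ba; case: (leqP b a) => ab.
    by rewrite itv_empty //= /sigma cards0 expr0 minor0 mul1r.
  have an : (a < n)%N by lia.
  have -> : itv n a b = [set Ordinal an].
    by apply/setP => k; rewrite !inE -val_eqE /=; lia.
  by rewrite /= /sigma cards1 expr0 mul1r minor_set1 mxE eqxx.
pose D i j := minor A (between i j) (between i j).
pose M i j := minor A (i |: between i j) (j |: between i j).
pose P i j := minor A (i |: between i j) (i |: between i j).
pose cF i j := if (i < j)%N then Face (between i j) i j else Face (between i j) j i.
pose V i j := i |: (j |: between i j).
(* The value that the minor with rows [i |: S] and columns [j |: S] must get, where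
   [S] is the open interval: read off the face if this minor is odd, and obtained
   from the vertex by Sylvester's identity otherwise. *)
pose target i j := if odd_ap (between i j) i j then sigma K (i |: between i j) * F (cF i j)
  else (P i j * P j i - sigma K (V i j) * F (Vertex (V i j)) * D i j)
       / (sigma K (j |: between i j) * F (cF j i)).
pose A' : 'M[K]_n := \matrix_(i, j) if index_dist i j == d.+1
  then A i j + border_sign K i j (between i j) * (target i j - M i j) / D i j else A i j.
have AA (i j : 'I_n) : index_dist i j != d.+1 -> A' i j = A i j.
  by rewrite mxE => /negbTE ->.
have cFC i j : i != j -> cF i j = cF j i.
  by rewrite -val_eqE /cF betweenC; case: ltngtP.
have DE i j : D i j = D j i by rewrite /D betweenC.
have VE i j : V i j = V j i by rewrite /V betweenC setUCA.
have A'n (X Y : {set 'I_n}) : (forall x y : 'I_n, x \in X -> y \in Y -> index_dist x y != d.+1) ->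
    minor A' X Y = minor A X Y.
  by move=> h; apply: eq_minor => x y xX yY; apply: AA; apply: h.
have VN a b : (b <= n)%N -> (b - a <= d.+1)%N -> minor A (itv n a b) (itv n a b) != 0.
  move=> bn ba; have := nz _ (in_U_itv a b); rewrite -gV //= mulf_eq0 negb_or.
  by case/andP.
have D0 (i j : 'I_n) : index_dist i j = d.+1 -> D i j != 0.
  wlog ij : i j / (i < j)%N.
    move=> H; case: (ltngtP i j) => ij dij; [exact: H | |];
      last by move: dij; rewrite ij /index_dist; lia.
    by rewrite DE; apply: H; rewrite // /index_dist addnC.
  move=> dij; rewrite /D between_lt //; apply: VN; first exact/ltnW/ltn_ord.
  by move: dij; rewrite /index_dist; lia.
have targetP (i j : 'I_n) : index_dist i j = d.+1 ->
    minor A' (i |: between i j) (j |: between i j) = target i j.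
  move=> dij; rewrite (@minor_entry _ _ A) ?between_notinl ?between_notinr //; last exact: D0.
    rewrite mxE dij eqxx addrAC subrr add0r mulrA mulrA border_sign_sqr mul1r divfK ?D0 //.
    by rewrite addrC subrK.
  move=> x y; rewrite !inE xpair_eqE -!val_eqE /= => xS yS xy; apply: AA.
  by move: dij xS yS xy; rewrite /index_dist; lia.
have Un (i j : 'I_n) : (i < j)%N -> in_U T0 (cF i j).
  by move=> ij; rewrite /cF ij /= between_lt // /T0 standard_itv.
have odd_btw (i j : 'I_n) : (i < j)%N -> odd_ap (between i j) i j = odd #|between i j| /\
    odd_ap (between j i) j i = ~~ odd #|between i j|.
  move=> ij; have nij : i != j by rewrite -val_eqE ltn_eqF.
  split; first by rewrite odd_apE // ltnNge ltnW.
  by rewrite odd_apE 1?eq_sym // ij betweenC.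
have prodP (i j : 'I_n) : (i < j)%N ->
    target i j * target j i = P i j * P j i - sigma K (V i j) * F (Vertex (V i j)) * D i j.
  move=> ij; have nij : i != j by rewrite -val_eqE ltn_eqF.
  have f0 := nz _ (Un _ _ ij).
  have [oij oji] := odd_btw _ _ ij.
  rewrite /target oij oji (betweenC j i) (cFC j i) 1?eq_sym //.
  by case: (odd _) => /=; [rewrite mulrC (DE j i) (VE j i) (mulrC (P j i))|];
     rewrite divfK // mulf_neq0 ?sigma_neq0.
exists A'; split=> [i j ij|a b bn].
  rewrite ltnS leq_eqVlt => /predU1P[dij|lt].
    have dI : index_dist i j = d.+1 by rewrite /index_dist; lia.
    have dJ : index_dist j i = d.+1 by rewrite /index_dist addnC.
    have nij : i != j by rewrite -val_eqE ltn_eqF.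
    rewrite mx_network_face // standard_itv -between_lt // targetP //.
    rewrite [X in minor A' (j |: X)]betweenC.
    have [oij oji] := odd_btw _ _ ij.
    rewrite [X in minor A' _ (i |: X)]betweenC targetP // /target oij oji.
    rewrite (betweenC j i) (cFC j i) 1?eq_sym // /cF ij.
    have si : sigma K (j |: between i j) = sigma K (i |: between i j).
      by rewrite /sigma !cardsU1 between_notinl between_notinr.
    by case: (odd _); rewrite /= ?si mulrA sigma_sqr mul1r.
  rewrite -gF // !mx_network_face // standard_itv !A'n // => x y;
    by rewrite !inE -!val_eqE /= /index_dist => xS yS; move: xS yS lt ij; lia.
rewrite leq_eqVlt => /predU1P[ba|lt]; last first.
  rewrite -gV //= A'n // => x y; rewrite !inE /index_dist; lia.
have an : (a < n)%N by lia.
have b1n : (b.-1 < n)%N by lia.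
pose i := Ordinal an; pose j := Ordinal b1n.
have ij : (i < j)%N by rewrite /=; lia.
have nij : i != j by rewrite -val_eqE ltn_eqF.
have dI : index_dist i j = d.+1 by rewrite /index_dist /=; lia.
have dJ : index_dist j i = d.+1 by rewrite /index_dist addnC.
have -> : itv n a b = V i j.
  by rewrite /V between_lt // -itv_consr // -itv_consl 1?ltnW //=; congr itv; lia.
have iI : i |: between i j = itv n i j by rewrite between_lt // -itv_consl.
have jI : j |: between i j = itv n i.+1 j.+1 by rewrite between_lt // -itv_consr.
have A'D : minor A' (between i j) (between i j) = D i j.
  by apply: A'n => x y; rewrite between_lt // !inE /index_dist /=; lia.
have A'i : minor A' (i |: between i j) (i |: between i j) = P i j.
  by apply: A'n => x y; rewrite iI !inE /index_dist /=; lia.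
have A'j : minor A' (j |: between i j) (j |: between i j) = P j i.
  by rewrite /P (betweenC j i); apply: A'n => x y; rewrite jI !inE /index_dist /=; lia.
have Pi0 : P i j != 0.
  by rewrite /P iI; apply: VN; rewrite /=; lia.
have Di0 := D0 _ _ dI.
have := @minor_Sylvester _ _ A' (between i j) i j.
rewrite between_notinl between_notinr A'D A'i A'j targetP // (betweenC i j) targetP // prodP //.
rewrite -(betweenC i j) opprB addrC subrK => /(_ isT isT nij Di0 Pi0).
move/(mulIf Di0); rewrite /= /V setUCA => ->.
by rewrite mulrA sigma_sqr mul1r.
Qed.

End Reconstruction.

(** * Tilings of sweeping point configurations *)

Section Sweep.
Variables (n : nat) (u : 'I_n -> rat).
Implicit Types (a b c i j k m p q r : 'I_n) (lam mu : rat).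

Let x k : rat := (k : nat)%:R.

(** The second divided difference of [u], taken at the indices as abscissae. *)
Definition divdiff a b c : rat :=
  u a / ((x a - x b) * (x a - x c)) + u b / ((x b - x a) * (x b - x c))
  + u c / ((x c - x a) * (x c - x b)).

Let divdiff3 a b c k : rat :=
  u a / ((x a - x b) * (x a - x c) * (x a - x k))
  + u b / ((x b - x a) * (x b - x c) * (x b - x k))
  + u c / ((x c - x a) * (x c - x b) * (x c - x k))
  + u k / ((x k - x a) * (x k - x b) * (x k - x c)).

Lemma divdiffC a b c : divdiff a b c = divdiff b a c.
Proof. by rewrite /divdiff [(x c - x a) * _]mulrC [u a / _ + _]addrC. Qed.

Lemma divdiffCA a b c : divdiff a b c = divdiff a c b.
Proof. by rewrite /divdiff [(x a - x b) * _]mulrC addrAC. Qed.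

Let subx_neq0 a b : a != b -> x a - x b != 0.
Proof. by rewrite subr_eq0 eqr_nat. Qed.

Let subx_gt0 a b : (0 < x a - x b) = (b < a)%N.
Proof. by rewrite subr_gt0 ltr_nat. Qed.

Let divdiff_sub a b c k : a != b -> a != c -> a != k -> b != c -> b != k -> c != k ->
  divdiff a b k - divdiff a b c = (x k - x c) * divdiff3 a b c k.
Proof.
move=> ab ac ak bc bk ck; rewrite /divdiff /divdiff3.
have [ba ca ka] : [/\ b != a, c != a & k != a] by rewrite ![_ == a]eq_sym.
have [cb kb kc] : [/\ c != b, k != b & k != c] by rewrite ![_ == b]eq_sym [k == c]eq_sym.
by field; rewrite !subx_neq0.
Qed.

Let divdiff3CA a b c k : divdiff3 a b c k = divdiff3 a c b k.
Proof.
rewrite /divdiff3 [_ + u b / _ + _]addrAC [(x a - x b) * _]mulrC.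
by rewrite [X in u k / X]mulrAC.
Qed.

Let divdiff3C a b c k : divdiff3 a b c k = divdiff3 b a c k.
Proof. by rewrite /divdiff3 [u a / _ + _]addrC [(x c - x a) * _]mulrC [(x k - x a) * _]mulrC. Qed.

(** The tiling of the arrangement with heights [u k - lam * k ^+ 2], where [m] is in
the label of [(i, j)] when its point lies above the chord through [i] and [j].
Starting from the intervals of the standard tiling, the triples with divided
difference above [lam] are inverted. *)
Definition sweep lam i j : {set 'I_n} :=
  [set m : 'I_n | (i < m < j)%N (+) [&& (i < j)%N, m != i, m != j & lam < divdiff i j m]]%SET.

Lemma in_sweep lam i j m : (m \in sweep lam i j) =
  (i < m < j)%N (+) [&& (i < j)%N, m != i, m != j & lam < divdiff i j m].
Proof. by rewrite inE. Qed.

Let mul_sub_gt0 a b (d : rat) : a != b -> d != 0 -> (0 < (x a - x b) * d) = (b < a)%N (+) (d < 0).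
Proof.
move=> ab d0; case: (ltngtP b a) => [ba|ba|/val_inj e]; last by rewrite e eqxx in ab.
- by rewrite pmulr_rgt0 ?subx_gt0 // addTb -leNgt le_eqVlt eq_sym (negbTE d0).
- by rewrite nmulr_rgt0 // subr_lt0 ltr_nat.
Qed.

Section Flip.
Variables (lam mu : rat) (p q r : 'I_n).
Hypotheses (pq : (p < q)%N) (qr : (q < r)%N) (pqr_mu : divdiff p q r = mu) (lam_mu : lam < mu).
Hypothesis gap : forall a b c, a != b -> a != c -> b != c ->
  lam < divdiff a b c -> mu <= divdiff a b c.
Hypothesis only : forall a b c, a != b -> a != c -> b != c -> divdiff a b c = mu ->
  {subset [:: a; b; c] <= [:: p; q; r]}.

Let npq : p != q. Proof. by rewrite -val_eqE ltn_eqF. Qed.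
Let nqr : q != r. Proof. by rewrite -val_eqE ltn_eqF. Qed.
Let npr : p != r. Proof. by rewrite -val_eqE ltn_eqF // (ltn_trans pq). Qed.
Let pr : (p < r)%N. Proof. exact: ltn_trans qr. Qed.

Let same a b c k : a != b -> a != c -> b != c -> k \in [:: a; b; c] ->
  k \notin [:: p; q; r] -> (lam < divdiff a b c) = (mu < divdiff a b c).
Proof.
move=> ab ac bc kabc kpqr; apply/idP/idP => [h|]; last exact: lt_trans.
rewrite lt_neqAle gap // andbT; apply: contraNneq kpqr => e.
by apply: only kabc.
Qed.

Let S := sweep mu p q.

Let out m : m \notin [:: p; q; r] ->
  (m \in sweep mu q r) = (m \in S) /\ (m \in sweep mu p r) = (m \in S).
Proof.
move=> mpqr; have := mpqr; rewrite !(in_sweep, inE) !negb_or => /and3P[mp mq mr].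
have [pm qm rm] : [/\ p != m, q != m & r != m] by rewrite ![_ == m]eq_sym.
(* Newton's recursion expresses the three gaps by one third divided difference. *)
have E1 : divdiff p q m - mu = (x m - x r) * divdiff3 p q r m by rewrite -pqr_mu divdiff_sub.
have E2 : divdiff q r m - mu = (x m - x p) * divdiff3 p q r m.
  by rewrite -pqr_mu (divdiffC p q) (divdiffCA q p) divdiff_sub // 1?eq_sym //
     (divdiff3CA q) (divdiff3C q).
have E3 : divdiff p r m - mu = (x m - x q) * divdiff3 p q r m.
  by rewrite -pqr_mu (divdiffCA p q r) divdiff_sub // 1?eq_sym // (divdiff3CA p).
have d0 : divdiff3 p q r m != 0.
  apply: contraNneq mpqr => d0; move: E1; rewrite d0 mulr0 => /eqP; rewrite subr_eq0.
  by move=> /eqP e; apply: (only _ _ _ e); rewrite ?inE ?eqxx ?orbT.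
rewrite pq qr pr mp mq mr /= -![mu < _]subr_gt0 E1 E2 E3 !mul_sub_gt0 //.
have ltm a : m != a -> (m < a)%N = ~~ (a < m)%N.
  by rewrite -val_eqE /= -leqNgt => ma; rewrite ltn_neqAle ma.
have qm_pm : (q < m)%N -> (p < m)%N by apply: ltn_trans.
have rm_qm : (r < m)%N -> (q < m)%N by apply: ltn_trans.
rewrite (ltm q mq) (ltm r mr); move: qm_pm rm_qm; case: (_ < 0);
  by case: (p < m)%N; case: (q < m)%N => //; case: (r < m)%N => // H1 H2;
     try (by have := H1 isT); try (by have := H2 isT).
Qed.

Let mem_lam i j m : (i < j)%N -> m \notin [:: p; q; r] ->
  (m \in sweep lam i j) = (m \in sweep mu i j).
Proof.
move=> ij mpqr; rewrite !(in_sweep, inE) ij /=; case: eqVneq => //= mi; case: eqVneq => //= mj.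
congr (_ (+) _); apply: (same (k := m)) => //.
- by rewrite -val_eqE ltn_eqF.
- by rewrite eq_sym.
- by rewrite eq_sym.
- by rewrite !(in_sweep, inE) eqxx !orbT.
Qed.

(** When [lam] passes the divided difference of a single triple, the three points
are collinear and every other point is on the same side of their three chords,
so the three tiles form a hexagon. *)
Lemma sweep_flip :
  [/\ [/\ p \notin S, q \notin S & r \notin S],
      hexagon_q (sweep mu) S p q r, hexagon_pr (sweep lam) S p q r &
      same_other_tiles (sweep mu) (sweep lam) p q r].
Proof.
have [qp rq rp] : [/\ (q < p)%N = false, (r < q)%N = false & (r < p)%N = false].
  by split; apply/negbTE; rewrite -leqNgt ltnW.
have [nqp nrq nrp] : [/\ q != p, r != q & r != p] by rewrite ![_ == p]eq_sym [r == q]eq_sym.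
have dqr : divdiff q r p = mu by rewrite divdiffCA divdiffC.
have dpr : divdiff p r q = mu by rewrite divdiffCA.
have pS : p \notin S by rewrite !(in_sweep, inE) ltnn eqxx /= andbF.
have qS : q \notin S by rewrite !(in_sweep, inE) ltnn eqxx /= ?andbF.
have rS : r \notin S by rewrite !(in_sweep, inE) pr rq pqr_mu ltxx /= ?andbF.
have ext (X Y : {set 'I_n}) :
    (forall m, m \notin [:: p; q; r] -> (m \in X) = (m \in Y)) ->
    (p \in X) = (p \in Y) -> (q \in X) = (q \in Y) -> (r \in X) = (r \in Y) -> X = Y.
  move=> h hp hq hr; apply/setP => m; case: (boolP (m \in [:: p; q; r])) => [|/h//].
  by rewrite !(in_sweep, inE) => /or3P[]/eqP->.
split.
- by [].
- split=> //; apply: ext => [m mpqr|||].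
  + by have [-> _] := out mpqr.
  + by rewrite (negbTE pS) !(in_sweep, inE) dqr ltxx qp /= ?andbF.
  + by rewrite (negbTE qS) !(in_sweep, inE) eqxx ltnn /= ?andbF.
  + by rewrite (negbTE rS) !(in_sweep, inE) eqxx ltnn /= ?andbF.
  + have [_ ->] := out mpqr; rewrite [in RHS]inE in_set1; case: eqVneq => // e.
    by rewrite e !(in_sweep, inE) eqxx orbT in mpqr.
  + by rewrite !in_setU1 (negbTE pS) (negbTE npq) !(in_sweep, inE) eqxx ltnn /= ?andbF.
  + by rewrite !in_setU1 eqxx in_sweep pq qr dpr ltxx ?andbF.
  + by rewrite !in_setU1 (negbTE rS) (negbTE nrq) !(in_sweep, inE) eqxx ltnn /= ?andbF.
- split; apply: ext => [m mpqr|||].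
  + by rewrite mem_lam //; have [_ ->] := out mpqr.
  + by rewrite (negbTE pS) !(in_sweep, inE) eqxx ltnn /= ?andbF.
  + by rewrite (negbTE qS) !(in_sweep, inE) pq qr pr nqp nqr dpr lam_mu.
  + by rewrite (negbTE rS) !(in_sweep, inE) eqxx ltnn /= ?andbF.
  + rewrite mem_lam // in_setU1; case: eqVneq => // e.
    by rewrite e !(in_sweep, inE) eqxx !orbT in mpqr.
  + by rewrite in_setU1 (negbTE pS) (negbTE npr) !(in_sweep, inE) eqxx ltnn /= ?andbF.
  + by rewrite in_setU1 (negbTE qS) (negbTE nqr) !(in_sweep, inE) eqxx ltnn /= ?andbF.
  + by rewrite in_setU1 eqxx !(in_sweep, inE) pq pr rq nrp nrq pqr_mu lam_mu.
  + rewrite mem_lam // in_setU1; have [-> _] := out mpqr; case: eqVneq => // e.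
    by rewrite e !(in_sweep, inE) eqxx in mpqr.
  + by rewrite in_setU1 eqxx !(in_sweep, inE) qr qp npq npr dqr lam_mu.
  + by rewrite in_setU1 (negbTE qS) (negbTE nqp) !(in_sweep, inE) eqxx ltnn /= ?andbF.
  + by rewrite in_setU1 (negbTE rS) (negbTE nrp) !(in_sweep, inE) eqxx ltnn /= ?andbF.
- move=> i j ij nij; apply/setP => m; rewrite !(in_sweep, inE) ij /=.
  case: eqVneq => //= mi; case: eqVneq => //= mj; congr (_ (+) _).
  have ij' : i != j by rewrite -val_eqE ltn_eqF.
  (* A tile other than the three has an index outside the flipped triple. *)
  have [k kij kn] : exists2 k, k \in [:: i; j; m] & k \notin [:: p; q; r].
    case: (boolP (i \in [:: p; q; r])) => iI; last by exists i; rewrite // !(in_sweep, inE) eqxx.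
    case: (boolP (j \in [:: p; q; r])) => jI;
      last by exists j; rewrite // !(in_sweep, inE) eqxx !orbT.
    move: iI jI nij ij; rewrite !(in_sweep, inE) !xpair_eqE.
    by move=> /or3P[]/eqP-> /or3P[]/eqP->; rewrite ?eqxx ?orbT ?ltnn ?qp ?rq ?rp.
  by apply: same kij kn => //; rewrite eq_sym.
Qed.

End Flip.

End Sweep.

(** Divided differences are symmetric, so a coincidence is compared up to the order
of the indices. *)
Definition separated n (u : 'I_n -> rat) := forall a b c a' b' c' : 'I_n,
  a != b -> a != c -> b != c -> a' != b' -> a' != c' -> b' != c' ->
  divdiff u a b c = divdiff u a' b' c' -> {subset [:: a; b; c] <= [:: a'; b'; c']}.

Section Reach.
Variables (K : fieldType) (n : nat) (A : 'M[K]_n).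
Let T0 := @standard_tiling n.
Hypothesis nz : forall N : network K n, net_equiv (T0, mx_network A) N ->
  forall c, in_U N.1 c -> N.2 c != 0.

Lemma divdiff_sorted (u : 'I_n -> rat) (a b c : 'I_n) : a != b -> a != c -> b != c ->
  exists p q r : 'I_n, (p < q < r)%N /\ divdiff u a b c = divdiff u p q r.
Proof.
rewrite -!val_eqE => ab ac bc.
have [lt_ab|lt_ba|e] := ltngtP a b; last by rewrite /= e eqxx in ab.
- have [lt_bc|lt_cb|e] := ltngtP b c; last by rewrite /= e eqxx in bc.
    by exists a, b, c; rewrite lt_ab.
  have [lt_ac|lt_ca|e] := ltngtP a c; last by rewrite /= e eqxx in ac.
    by exists a, c, b; rewrite lt_ac divdiffCA.
  by exists c, a, b; rewrite lt_ca lt_ab divdiffCA divdiffC.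
- have [lt_ac|lt_ca|e] := ltngtP a c; last by rewrite /= e eqxx in ac.
    by exists b, a, c; rewrite lt_ba divdiffC.
  have [lt_bc|lt_cb|e] := ltngtP b c; last by rewrite /= e eqxx in bc.
    by exists b, c, a; rewrite lt_bc divdiffC divdiffCA.
  by exists c, b, a; rewrite lt_cb lt_ba divdiffC divdiffCA divdiffC.
Qed.

(** Induction on the number of triples above [lam]: the least of them is flipped
last.  The values stay those of [A] because [A] satisfies the hexahedron
relation at each flip, where the old values are nonzero by hypothesis. *)
Lemma sweep_reach (u : 'I_n -> rat) lam : separated u ->
  net_equiv (T0, mx_network A) (sweep u lam, mx_network A).
Proof.
move=> sep.
pose trip (t : 'I_n * 'I_n * 'I_n) := (t.1.1 < t.1.2 < t.2)%N.
pose d (t : 'I_n * 'I_n * 'I_n) := divdiff u t.1.1 t.1.2 t.2.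
pose C mu := [set t | trip t && (mu < d t)]%SET.
have [m] := ubnP #|C lam|; elim: m => // m IH in lam *; rewrite ltnS => le_m.
have inC mu a b c : a != b -> a != c -> b != c -> mu < divdiff u a b c ->
    exists2 t, t \in C mu & d t = divdiff u a b c.
  move=> ab ac bc; have [p [q [r [pqr ->]]]] := divdiff_sorted u ab ac bc => lt.
  by exists (p, q, r) => //; rewrite inE /trip /= pqr.
case: (set_0Vmem (C lam)) => [C0|[t0 t0C]].
  have -> : sweep u lam = T0; last exact: rt_refl.
  apply/funext => i; apply/funext => j; apply/setP => k; rewrite in_sweep !inE.
  case: (boolP [&& _, _, _ & _]); last by rewrite addbF.
  case/and4P=> ij ki kj lt.
  have [||||t] := inC lam i j k; rewrite ?C0 ?inE //.
  - by rewrite -val_eqE ltn_eqF.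
  - by rewrite eq_sym.
  - by rewrite eq_sym.
case: (arg_minP d t0C) => -[[p q] r] tC tmin; set mu := d (p, q, r) in tmin.
have {}tC : (p, q, r) \in C lam by [].
move: (tC); rewrite inE /trip /= => /andP[/andP[pq qr] lam_mu].
have {}IH : net_equiv (T0, mx_network A) (sweep u mu, mx_network A).
  apply: IH; apply: leq_trans le_m; apply: proper_card.
  apply/properP; split; last by exists (p, q, r); rewrite // inE ltxx andbF.
  by apply/subsetP => t; rewrite !inE => /andP[-> /(lt_trans lam_mu)].
have gap a b c : a != b -> a != c -> b != c -> lam < divdiff u a b c -> mu <= divdiff u a b c.
  by move=> ab ac bc lt; have [t tCl <-] := inC lam a b c ab ac bc lt; apply: tmin.
have pqn : p != q by rewrite -val_eqE ltn_eqF.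
have qrn : q != r by rewrite -val_eqE ltn_eqF.
have prn : p != r by rewrite -val_eqE ltn_eqF // (ltn_trans pq).
have only a b c : a != b -> a != c -> b != c -> divdiff u a b c = mu ->
    {subset [:: a; b; c] <= [:: p; q; r]}.
  by move=> ab ac bc; apply: sep.
have [nS hq hpr hs] := @sweep_flip n u lam mu p q r pq qr erefl lam_mu gap only.
set S := sweep u mu p q in nS hq hpr.
apply: (rt_trans _ _ _ _ _ IH); apply: rt_step; apply: Or31.
exists S, p, q, r; rewrite pq qr; do 2 split=> //; split=> //.
have mnz X : is_vertex (sweep u mu) X -> minor A X X != 0.
  by move=> vX; have := nz IH (c := Vertex X) vX; rewrite /= mulf_eq0 negb_or => /andP[].
have [Tpq Tqr Tpr] := hq.
have [vS vp vq vpq] : [/\ is_vertex (sweep u mu) S, is_vertex (sweep u mu) (p |: S),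
    is_vertex (sweep u mu) (q |: S) & is_vertex (sweep u mu) (p |: (q |: S))].
  by split; exists p, q; rewrite Tpq !inE eqxx ?orbT.
have vr : is_vertex (sweep u mu) (r |: S) by exists q, r; rewrite Tqr !inE eqxx ?orbT.
by apply: mx_hexahedron; rewrite ?pq ?qr //; apply: mnz.
Qed.

End Reach.

Lemma nonroot_large (p : {poly rat}) B : p != 0 -> exists2 m : nat, (B < m)%N & p.[m%:R] != 0.
Proof.
move=> p0; apply: contrapT => h.
pose s : seq rat := [seq (B.+1 + k)%:R | k <- iota 0 (size p)].
have: (size s < size p)%N.
  apply: max_poly_roots => //.
    apply/allP => y /mapP[k _ ->]; apply/rootP/eqP; apply: contrapT => nr; apply: h.
    by exists (B.+1 + k)%N; [rewrite ltnS leq_addr | apply/negP].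
  by rewrite map_inj_uniq ?iota_uniq // => k l /eqP; rewrite eqr_nat eqn_add2l => /eqP.
by rewrite size_map size_iota ltnn.
Qed.

(** Take [u k = x ^+ w k] with a sign that tells whether [k] is in [S], for distinct
exponents that are least at [i] and [j].  For large [x] the sign of [u k] decides
on which side of the chord through [i] and [j] the point [k] lies.  A coincidence
of two divided differences is a nonzero polynomial equation for [x]. *)
Lemma exists_sweep n (S : {set 'I_n}) (i j : 'I_n) : (i < j)%N -> i \notin S -> j \notin S ->
  exists2 u : 'I_n -> rat, separated u & sweep u 0 i j = S.
Proof.
move=> ij iS jS.
have nij : i != j by rewrite -val_eqE ltn_eqF.
pose w (k : 'I_n) : nat := if k == i then 0 else if k == j then 1 else k.+2.
have w_inj : injective w.
  by move=> a b; rewrite /w; do ![case: eqVneq => [->|_]] => // -[/val_inj].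
pose s (k : 'I_n) : rat := if k \in S then 1 else -1.
have s0 k : s k != 0 by rewrite /s; case: ifP; rewrite ?oner_eq0 ?oppr_eq0 ?oner_eq0.
pose x (k : 'I_n) : rat := (k : nat)%:R.
have x0 a b : a != b -> x a - x b != 0 by rewrite subr_eq0 eqr_nat.
pose e a b c := s a / ((x a - x b) * (x a - x c)).
pose P a b c : {poly rat} := e a b c *: 'X^(w a) + e b a c *: 'X^(w b) + e c a b *: 'X^(w c).
pose Q (t : 'I_n * 'I_n * 'I_n * ('I_n * 'I_n * 'I_n)) : {poly rat} :=
  P t.1.1.1 t.1.1.2 t.1.2 - P t.2.1.1 t.2.1.2 t.2.2.
have [|m m_gt] := @nonroot_large (\prod_(t | Q t != 0) Q t) (2 * n).
  by apply/prodf_neq0.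
rewrite horner_prod => /prodf_neq0 => Qm.
pose u k : rat := s k * m%:R ^+ w k.
have PE a b c : (P a b c).[m%:R] = divdiff u a b c.
  by rewrite /P !hornerE /divdiff /u /e /x mulrAC
    [X in _ + X + _]mulrAC [X in _ + X]mulrAC.
have Q0 a b c a' b' c' : divdiff u a b c = divdiff u a' b' c' -> P a b c = P a' b' c'.
  move=> E; apply/eqP; rewrite -subr_eq0; apply/negPn/negP => nz.
  by have := Qm (a, b, c, (a', b', c')) nz; rewrite /Q /= hornerD hornerN !PE E subrr eqxx.
have mem_first a b c a' b' c' : a != b -> a != c -> divdiff u a b c = divdiff u a' b' c' ->
    a \in [:: a'; b'; c'].
  move=> ab ac /Q0 /(congr1 (fun p : {poly rat} => p`_(w a))).
  rewrite /P !coefD !coefZ !coefXn !(inj_eq w_inj) eqxx mulr1 (negbTE ab) (negbTE ac).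
  rewrite !mulr0 !addr0 !inE; do 3 case: eqP => //=; rewrite !mulr0 !addr0 => _ _ _ /eqP.
  by rewrite /e !mulf_eq0 invr_eq0 mulf_eq0 (negbTE (s0 a)) !(negbTE (x0 _ _ _)).
exists u.
  move=> a b c a' b' c' ab ac bc _ _ _ E k.
  rewrite !(in_cons, in_nil, orbF) => /or3P[]/eqP->.
  - have := mem_first a b c a' b' c' ab ac E; by rewrite !inE.
  - have := mem_first b a c a' b' c'; rewrite eq_sym ab bc -divdiffC !inE; exact.
  - have := mem_first c a b a' b' c'; rewrite 2![c == _]eq_sym ac bc !inE => /(_ isT isT); apply.
    by rewrite divdiffC divdiffCA.
apply/setP => k; rewrite in_sweep ij /=.
case: eqVneq => [->|ki]; first by rewrite ltnn (negbTE iS).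
case: eqVneq => [->|kj]; first by rewrite ltnn andbF (negbTE jS).
have ik : i != k by rewrite eq_sym.
have jk : j != k by rewrite eq_sym.
(* Up to a positive factor, the height of point [k] above the chord. *)
pose W := divdiff u i j k * ((x k - x i) * (x k - x j)) * (x j - x i).
have WE : W = u k * (x j - x i) - (u i * (x j - x k) + u j * (x k - x i)).
  by rewrite /W /divdiff -/(x i) -/(x j) -/(x k); field; rewrite !x0 // eq_sym.
have ui : u i = -1 by rewrite /u /w /s eqxx (negbTE iS) expr0 mulr1.
have uj : u j = - m%:R.
  by rewrite /u /w /s eq_sym (negbTE nij) eqxx (negbTE jS) expr1 mulN1r.
have uk : u k = s k * m%:R ^+ k.+2 by rewrite /u /w (negbTE ki) (negbTE kj).
have n1 : 1 <= n%:R :> rat by rewrite ler1n; have := ltn_ord i; lia.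
have mn : 2 * n%:R + 1 <= m%:R :> rat by rewrite -natrM natr1 ler_nat.
have M2 : m%:R ^+ 2 <= m%:R ^+ k.+2 :> rat by apply: ler_weXn2l => //; lra.
have xji : 1 <= x j - x i by rewrite lerBrDl natr1 ler_nat.
have xb (l : 'I_n) : 0 <= x l <= n%:R by rewrite ler0n ler_nat ltnW // ltn_ord.
have := xb i; have := xb j; have := xb k; move: xji WE M2 mn n1; rewrite ui uj uk.
set M := m%:R ^+ k.+2; set mm : rat := m%:R; set nn : rat := n%:R.
move=> xji WE M2 mn n1 /andP[k0 kn] /andP[j0 jn] /andP[i0 iN].
(* [u k] dominates: its absolute value is at least [m ^ 2], and [m > 2 n]. *)
have WS : if k \in S then 0 < W else W < 0.
  have mm0 : 0 <= mm by lra.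
  have M0 : 0 <= M by apply: le_trans M2; exact: sqr_ge0.
  have h1 : mm * (x k - x i) <= mm * nn by apply: ler_wpM2l => //; lra.
  have h2 : mm * - nn <= mm * (x k - x i) by apply: ler_wpM2l => //; lra.
  have h3 : mm * (2 * nn + 1) <= M.
    by apply: le_trans M2; rewrite expr2; apply: ler_wpM2l.
  have h4 : M * 1 <= M * (x j - x i) by apply: ler_wpM2l.
  have h5 : 0 <= mm * nn by apply: mulr_ge0 => //; lra.
  by rewrite WE /s; case: (k \in S); lra.
have xji0 : 0 < x j - x i by apply: lt_le_trans xji.
have lx (a b : 'I_n) : (a < b)%N -> x a - x b < 0 by rewrite subr_lt0 ltr_nat.
have lx' (a b : 'I_n) : (a < b)%N -> 0 < x b - x a by rewrite subr_gt0 ltr_nat.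
have [out|inn] : (0 < (x k - x i) * (x k - x j) /\ (i < k < j)%N = false) \/
    ((x k - x i) * (x k - x j) < 0 /\ (i < k < j)%N).
  have [lt_ki|lt_ik|/val_inj ek] := ltngtP k i; last by rewrite ek eqxx in ki.
    by left; rewrite nmulr_rgt0 ?lx // (ltn_trans lt_ki).
  have [lt_kj|lt_jk|/val_inj ek] := ltngtP k j; last by rewrite ek eqxx in kj.
    by right; rewrite pmulr_rlt0 ?lx' ?lx.
  by left; rewrite mulr_gt0 ?lx'.
- move: WS; case: out => P0 ->; rewrite /W pmulr_llt0 // pmulr_lgt0 //.
  rewrite pmulr_llt0 // pmulr_lgt0 //=; case: ifP => // _ d0.
  by apply/negbTE; rewrite -leNgt ltW.
- move: WS; case: inn => P0 ->; rewrite /W pmulr_llt0 // pmulr_lgt0 //.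
  rewrite nmulr_llt0 // nmulr_lgt0 //=; case: ifP => // _ d0; last by rewrite d0.
  by rewrite ltNge ltW.
Qed.

(** * The standard tiling as a tiling of the polygon *)

Section Plane.
Variables (R : realType) (n : nat).
Implicit Types (d t : 'I_n -> R) (i j k c m : 'I_n) (S X Y : {set 'I_n}).

Definition angle k : R := pi * k%:R / n%:R.

(** All points of the polygon, with real coefficients instead of subsets. *)
Definition edge_comb d : R[i] := \sum_k (d k)%:C%C * edge_vec R k.

Lemma edge_combE d :
  edge_comb d = ((\sum_k d k * cos (angle k)) +i* (\sum_k d k * sin (angle k)))%C.
Proof.
rewrite /edge_comb /angle; elim/big_ind3: _ => // [a b a' b' a'' b'' -> ->|k _] //.
by apply/eqP; rewrite eq_complex /= !mul0r subr0 addr0 !eqxx.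
Qed.

Lemma edge_comb_eq d t : edge_comb d = edge_comb t ->
  \sum_k d k * cos (angle k) = \sum_k t k * cos (angle k) /\
  \sum_k d k * sin (angle k) = \sum_k t k * sin (angle k).
Proof. by rewrite !edge_combE => -[]. Qed.

Lemma edge_combB d t : edge_comb (fun k => d k - t k) = edge_comb d - edge_comb t.
Proof. by rewrite /edge_comb -sumrB; apply: eq_bigr => k _; rewrite rmorphB mulrBl. Qed.

Lemma edge_combD d t : edge_comb (fun k => d k + t k) = edge_comb d + edge_comb t.
Proof. by rewrite /edge_comb -big_split; apply: eq_bigr => k _; rewrite rmorphD mulrDl. Qed.

Lemma pt_edge_comb S : pt R S = edge_comb (fun k => (k \in S)%:R).
Proof.
rewrite /pt /edge_comb [LHS]big_mkcond; apply: eq_bigr => k _.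
by case: (k \in S); rewrite ?rmorph1 ?rmorph0 ?mul1r ?mul0r.
Qed.

Lemma sin_angle_gt0 k c : (k < c)%N -> 0 < sin (angle c - angle k).
Proof.
move=> kc; apply: sin_gt0_pi; rewrite /angle -mulrBl -mulrBr.
have n0 : 0 < n%:R :> R by rewrite ltr0n (leq_ltn_trans _ (ltn_ord c)).
rewrite -natrB 1?ltnW //; apply/andP; split.
  by rewrite divr_gt0 // mulr_gt0 ?pi_gt0 // ltr0n subn_gt0.
rewrite ltr_pdivrMr // ltr_pM2l ?pi_gt0 // ltr_nat.
by rewrite (leq_ltn_trans (leq_subr _ _)).
Qed.

(** The component orthogonal to [e_c] of the relation is a sum of terms
[d k * sin (angle c - angle k)] of one sign, so all of them vanish. *)
Lemma one_sign_change d c : edge_comb d = 0 ->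
  (forall k, (k < c)%N -> 0 <= d k) -> (forall k, (c < k)%N -> d k <= 0) ->
  forall k, d k = 0.
Proof.
rewrite edge_combE => -[dcos dsin] pos neg.
have ge0 k : 0 <= d k * sin (angle c - angle k).
  have [lt|lt|/val_inj ->] := ltngtP k c.
  - by rewrite mulr_ge0 ?pos // ltW ?sin_angle_gt0.
  - by rewrite -opprB sinN mulrN -mulNr mulr_ge0 ?oppr_ge0 ?neg // ltW ?sin_angle_gt0.
  - by rewrite subrr sin0 mulr0.
have sum0 : \sum_k d k * sin (angle c - angle k) = 0.
  transitivity (sin (angle c) * (\sum_k d k * cos (angle k))
                - cos (angle c) * \sum_k d k * sin (angle k)).
    rewrite !big_distrr -sumrB; apply: eq_bigr => k _ /=.
    by rewrite sinB; ring.
  by rewrite dcos dsin !mulr0 subr0.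
have dk k : k != c -> d k = 0.
  move=> kc; have := psumr_eq0P (fun k _ => ge0 k) sum0 => /(_ k isT)/eqP.
  rewrite mulf_eq0 => /orP[/eqP//|/eqP s0].
  have [lt|lt|/val_inj e] := ltngtP k c; last by rewrite e eqxx in kc.
    by have := sin_angle_gt0 lt; rewrite s0 ltxx.
  by have := sin_angle_gt0 lt; rewrite -opprB sinN s0 oppr0 ltxx.
move=> k; have [->|/dk//] := eqVneq k c.
have single (f : 'I_n -> R) : \sum_k d k * f k = d c * f c.
  by rewrite (bigD1 c) //= big1 ?addr0 // => l /dk ->; rewrite mul0r.
move: dcos dsin; rewrite !single.
move=> /eqP; rewrite mulf_eq0 => /orP[/eqP//|/eqP c0] /eqP.
rewrite mulf_eq0 => /orP[/eqP//|/eqP s0].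
by have := cos2Dsin2 (angle c); rewrite c0 s0 expr0n addr0 => /eqP; rewrite eq_sym oner_eq0.
Qed.

(** The difference of the indicators of two intervals has one sign change, at the
end of the interval that starts first. *)
Lemma pt_itv_inj a b a' b' :
  pt R (itv n a b) = pt R (itv n a' b') -> itv n a b = itv n a' b'.
Proof.
wlog le : a b a' b' / (a <= a')%N.
  move=> H e; case: (leqP a a') => l; first exact: H.
  by apply: esym; apply: H => //; apply: ltnW.
rewrite !pt_edge_comb => e.
suff d0 k : (k \in itv n a b)%:R - (k \in itv n a' b')%:R = 0 :> R.
  apply/setP => k; have /eqP := d0 k; rewrite subr_eq0 eqr_nat.
  by case: (_ \in _); case: (_ \in _).
have e0 : edge_comb (fun k => (k \in itv n a b)%:R - (k \in itv n a' b')%:R) = 0.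
  by rewrite edge_combB e subrr.
have [X0|[l]] := set_0Vmem (itv n a b).
  have kn := ltn_ord k.
  have n0 : (0 < n)%N by apply: leq_ltn_trans kn.
  apply: (one_sign_change (c := Ordinal n0) e0) => // m _.
  by rewrite X0 inE sub0r oppr_le0 ler0n.
rewrite inE => lab; have lt_n : ((minn b n).-1 < n)%N by have := ltn_ord l; lia.
apply: (one_sign_change (c := Ordinal lt_n) e0) => m /=; rewrite !inE => lt.
  case: (boolP (a' <= m < b')%N) => h.
    have -> : (a <= m < b)%N by move: h; have := ltn_ord m; lia.
    by rewrite subrr.
  by rewrite subr0 ler0n.
have -> : (a <= m < b)%N = false by have := ltn_ord m; lia.
by rewrite sub0r oppr_le0 ler0n.
Qed.

(** The coefficients of the points of the standard rhombus of [i] and [j]. *)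
Definition profile i j (s t : R) k : R :=
  if k == i then s else if k == j then t else (i < k < j)%N%:R.

Lemma rhombus_profile i j (s t : R) : (i < j)%N ->
  pt R (standard_tiling i j) + s%:C%C * edge_vec R i + t%:C%C * edge_vec R j
  = edge_comb (profile i j s t).
Proof.
move=> ij; have nij : i != j by rewrite -val_eqE ltn_eqF.
have D (f : 'I_n -> R[i]) :
    \sum_k f k = f i + (f j + \sum_(k | (k != i) && (k != j)) f k).
  by rewrite (bigD1 i) //= (bigD1 j) //= eq_sym.
rewrite pt_edge_comb /edge_comb /profile !D !eqxx eq_sym (negbTE nij) !inE !ltnn andbF /=.
rewrite !rmorph0 !mul0r !add0r -addrA addrC -addrA; congr (_ + (_ + _)).
apply: eq_bigr => k /andP[ki kj].
by rewrite (negbTE ki) (negbTE kj) inE.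
Qed.

End Plane.

Section Disjoint.
Variables (R : realType) (n : nat).
Implicit Types (i j k l c m : 'I_n).
Let T0 := @standard_tiling n.

Lemma profile_lt i j (s t : R) k : (i < j)%N -> (k < i)%N -> profile i j s t k = 0.
Proof.
move=> ij ki; rewrite /profile -!val_eqE /=; case: eqP => [?|_]; first lia.
case: eqP => [?|_]; first lia.
by have -> : (i < k < j)%N = false by lia.
Qed.

Lemma profile_gt i j (s t : R) k : (i < j)%N -> (j < k)%N -> profile i j s t k = 0.
Proof.
move=> ij jk; rewrite /profile -!val_eqE /=; case: eqP => [?|_]; first lia.
case: eqP => [?|_]; first lia.
by have -> : (i < k < j)%N = false by lia.
Qed.

Lemma profile_in i j (s t : R) k : (i < k < j)%N -> profile i j s t k = 1.
Proof.
move=> ikj; rewrite /profile -!val_eqE /= ikj; case: eqP => [?|_]; first lia.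
by case: eqP => [?|_]; first lia.
Qed.

Lemma profilel i j (s t : R) : profile i j s t i = s.
Proof. by rewrite /profile eqxx. Qed.

Lemma profiler i j (s t : R) : (i < j)%N -> profile i j s t j = t.
Proof. by move=> ij; rewrite /profile eqxx -val_eqE /= gtn_eqF. Qed.

Lemma profile_ge0 i j (s t : R) k : 0 <= s -> 0 <= t -> 0 <= profile i j s t k.
Proof. by move=> s0 t0; rewrite /profile; do 2 case: ifP => // _; rewrite ler0n. Qed.

Lemma profile_le1 i j (s t : R) k : s <= 1 -> t <= 1 -> profile i j s t k <= 1.
Proof. by move=> s0 t0; rewrite /profile; do 2 case: ifP => // _; rewrite lern1 leq_b1. Qed.

(** The difference of two profiles has at most one sign change. *)
Lemma standard_disjoint i j k l (z : R[i]) : (i < j)%N -> (k < l)%N ->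
  open_rhombus (T0 i j) i j z -> open_rhombus (T0 k l) k l z -> i = k /\ j = l.
Proof.
move=> ij kl [s [t [s01 t01 zE]]] [s' [t' [s01' t01' zE']]].
move: zE zE'; rewrite !rhombus_profile // => -> {z}.
wlog : i j k l s t s' t' ij kl s01 t01 s01' t01' / (i < k)%N || (i == k) && (j <= l)%N.
  move=> H e; case: (boolP ((i < k)%N || (i == k) && (j <= l)%N)) => h.
    exact: (H _ _ _ _ _ _ _ _ ij kl s01 t01 s01' t01').
  have [||-> ->] // := H _ _ _ _ _ _ _ _ kl ij s01' t01' s01 t01.
  by move: h; rewrite -!val_eqE /=; lia.
move: s01 t01 s01' t01' => /andP[s0 s1] /andP[t0 t1] /andP[s0' s1'] /andP[t0' t1'].
move=> h e.
have e0 : edge_comb (fun m => profile i j s t m - profile k l s' t' m) = 0.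
  by rewrite edge_combB e subrr.
case/orP: h => [ik|/andP[/eqP ik jl]].
  have d0 := one_sign_change (c := j) e0.
  have : profile i j s t i - profile k l s' t' i = 0.
    apply: d0 => m lt; last first.
      by rewrite profile_gt // sub0r oppr_le0 profile_ge0 // ltW.
    have [im|mi] := ltnP i m.
      by rewrite profile_in ?im ?lt // subr_ge0 profile_le1 // ltW.
    rewrite [X in _ - X]profile_lt ?subr0 ?profile_ge0 ?ltW //.
    exact: leq_ltn_trans ik.
  by rewrite profilel profile_lt // subr0 => s_0; rewrite s_0 ltxx in s0.
subst k; split=> //; apply/val_inj/eqP; rewrite /= eqn_leq jl /= leqNgt.
apply/negP => {}jl.
have : profile i j s t j - profile i l s' t' j = 0.
  apply: (one_sign_change (c := i) e0) => m lt.
    by rewrite !profile_lt // subrr.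
  have [ml|lm] := ltnP m l.
    by rewrite [X in _ - X]profile_in ?lt ?ml // subr_le0 profile_le1 // ltW.
  rewrite profile_gt ?sub0r ?oppr_le0 ?profile_ge0 ?ltW //.
  exact: leq_trans lm.
rewrite profiler // profile_in ?ij ?jl // => /eqP; rewrite subr_eq0 => /eqP t_1.
by rewrite t_1 ltxx in t1.
Qed.

End Disjoint.

Section Walks.
Variables (R : realType) (n : nat).
Hypothesis n1 : (1 < n)%N.
Implicit Types (i j k l c m : 'I_n) (X Y : {set 'I_n}) (v w : R[i]).
Let T0 := @standard_tiling n.

Definition is_itv X := exists a b, X = itv n a b.

Lemma tile_edge_standard v k : tile_edge T0 v k ->
  exists X, [/\ is_itv X, is_itv (k |: X), k \notin X & v = pt R X].
Proof.
move=> [i [j [ij]]]; rewrite /T0 standard_itv -itv_consl // -itv_consr //.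
have iS : i \notin itv n i.+1 j by rewrite inE ltnn.
have jS : j \notin itv n i.+1 j by rewrite inE ltnn andbF.
case=> -[-> [->|->]].
- exists (itv n i.+1 j); split=> //; first by do 2 eexists.
  by rewrite -itv_consl //; do 2 eexists.
- exists (itv n i.+1 j.+1); split=> //; first by do 2 eexists.
    by rewrite -itv_consl ?ltnS 1?ltnW //; do 2 eexists.
  by rewrite inE ltnn.
- exists (itv n i.+1 j); split=> //; first by do 2 eexists.
  by rewrite -itv_consr //; do 2 eexists.
- exists (itv n i j); split=> //; first by do 2 eexists.
    by rewrite -itv_consr 1?ltnW //; do 2 eexists.
  by rewrite inE ltnn andbF.
Qed.

Lemma pt_setU1 k X : k \notin X -> pt R (k |: X) = pt R X + edge_vec R k.
Proof. by move=> kX; rewrite /pt big_setU1 //= addrC. Qed.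

Lemma is_itv_inj X Y : is_itv X -> is_itv Y -> pt R X = pt R Y -> X = Y.
Proof. by move=> [a [b ->]] [a' [b' ->]]; apply: pt_itv_inj. Qed.

(** As points of intervals determine the intervals, a walk lifts to labels, and
each step adds or removes one element. *)
Lemma walk_label v s w : walk T0 v s w -> forall X, is_itv X -> v = pt R X ->
  exists Y, [/\ is_itv Y, w = pt R Y,
    (#|Y| + count (fun e => ~~ e.2) s = #|X| + count (fun e => e.2) s)%N &
    forall k, ((k \in Y) + count_mem (k, false) s = (k \in X) + count_mem (k, true) s)%N].
Proof.
elim=> {v s w} [v|v k s w ed _ IH|v k s w ed _ IH] X iX vX.
- by exists X; split=> //= k; rewrite !addn0.
- have [Z [iZ iZ' kZ vZ]] := tile_edge_standard ed.
  have ZX : Z = X by apply: is_itv_inj; rewrite // -vZ -vX.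
  have vE : v + edge_vec R k = pt R (k |: X) by rewrite vX pt_setU1 // -ZX.
  have [|Y [iY wY cY kY]] := IH _ _ vE; first by rewrite -ZX.
  exists Y; split=> //=.
    by rewrite add0n cY cardsU1 -ZX kZ [RHS]addnCA addnA.
  move=> l; rewrite !xpair_eqE andbF andbT kY !inE eq_sym -ZX.
  by case: eqVneq => [<-|_] //=; rewrite (negbTE kZ).
- have [Z [iZ iZ' kZ vZ]] := tile_edge_standard ed.
  have vE : v = pt R (k |: Z) by rewrite pt_setU1 // -vZ subrK.
  have ZX : X = k |: Z by apply: is_itv_inj; rewrite // -vE -vX.
  have [Y [iY wY cY kY]] := IH _ iZ vZ.
  exists Y; split=> //=.
    by rewrite add0n addnCA cY ZX cardsU1 kZ addnA.
  move=> l; rewrite !xpair_eqE andbF andbT addnCA kY ZX !inE eq_sym.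
  by case: eqVneq => [->|_] //=; rewrite (negbTE kZ).
Qed.

Lemma walk_rcons v s w k : walk T0 v s w -> tile_edge T0 w k ->
  walk T0 v (rcons s (k, true)) (w + edge_vec R k).
Proof.
elim=> {v s w} [v|v l s w ed _ IH|v l s w ed _ IH] h /=.
- by apply: walk_up => //; apply: walk_nil.
- by apply: walk_up => //; apply: IH.
- by apply: walk_down => //; apply: IH.
Qed.

Lemma up_walk a b : (b <= n)%N ->
  exists s, walk T0 (0 : R[i]) s (pt R (itv n a b)) /\ all (fun e => e.2) s.
Proof.
elim: b => [|b IH] bn.
  exists [::]; split=> //; rewrite itv_empty // /pt big_set0; exact: walk_nil.
case: (leqP b.+1 a) => [ba|ab].
  exists [::]; split=> //; rewrite itv_empty // /pt big_set0; exact: walk_nil.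
have [s [ws als]] := IH (ltnW bn).
pose k := Ordinal bn.
exists (rcons s (k, true)); rewrite all_rcons als; split=> //.
have -> : itv n a b.+1 = k |: itv n a k by rewrite -itv_consr.
rewrite pt_setU1; last by rewrite inE ltnn andbF.
apply: walk_rcons => //.
case: (ltnP a b) => [lt|le].
  have an : (a < n)%N by apply: (ltn_trans lt).
  exists (Ordinal an), k; split=> //; right; split=> //; right.
  by rewrite /T0 standard_itv -itv_consl.
have -> : itv n a k = finset.set0 by apply: itv_empty.
case: (ltnP b.+1 n) => [lt|le'].
  exists k, (Ordinal lt); split=> //; left; split=> //; left.
  by rewrite /T0 standard_itv itv_empty.
have b1 : (b.-1 < n)%N by lia.
exists (Ordinal b1), k; split; first by rewrite /=; lia.
right; split=> //; left.
by rewrite /T0 standard_itv itv_empty //=; lia.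
Qed.

(** A walk to [X] of length [#|X|] exists and is shortest, and a walk of this length
has no downward step; it therefore adds exactly the elements of [X]. *)
Lemma standard_label X : is_vertex T0 X -> forall k,
  k \in X <-> exists s, shortest_walk T0 (0 : R[i]) s (pt R X) /\ (k, true) \in s.
Proof.
move=> /(vertex_standard _ n1)[a [b XE]].
have iX : is_itv X by exists a, b.
have lab s : walk T0 (0 : R[i]) s (pt R X) ->
  (#|X| + count (fun e => ~~ e.2) s = count (fun e => e.2) s)%N /\
  forall k, ((k \in X) + count_mem (k, false) s = count_mem (k, true) s)%N.
  move=> ws; have [||Y [iY pY cY kY]] := walk_label ws (X := finset.set0).
  - by exists 0, 0; rewrite itv_empty.
  - by rewrite /pt big_set0.
  have YX : X = Y by apply: is_itv_inj.
  by rewrite YX cY cards0; split=> // k; rewrite kY inE.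
have sz (s : seq ('I_n * bool)) : (size s = count (fun e => e.2) s + count (fun e => ~~ e.2) s)%N.
  by rewrite (count_predC (fun e => e.2)).
have [s0 [ws0 als0]] : exists s, walk T0 (0 : R[i]) s (pt R X) /\ all (fun e => e.2) s.
  by rewrite XE itv_minn; apply: up_walk; exact: geq_minr.
have s0X : size s0 = #|X|.
  have [c0 _] := lab _ ws0; move: als0; rewrite all_count => /eqP e.
  by have := sz s0; lia.
move=> k; split=> [kX|[s [[ws smin] ks]]].
  exists s0; split; first split=> // s ws.
    by have [c0 _] := lab _ ws; rewrite s0X sz; lia.
  have [_ /(_ k) e] := lab _ ws0; rewrite -has_pred1 has_count -e kX.
  by rewrite add1n.
have [c0 /(_ k) ck] := lab _ ws.
have downs0 : count (fun e => ~~ e.2) s = 0%N.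
  by have := smin _ ws0; rewrite s0X sz; lia.
have : count_mem (k, false) s = 0%N.
  apply/eqP; rewrite -leqn0 -downs0; apply: sub_count => e /eqP -> //.
move=> e; move: ks; rewrite -has_pred1 has_count -ck e addn0.
by case: (k \in X).
Qed.

End Walks.

Section Cover.
Variables (R : realType) (n : nat).
Hypothesis n1 : (1 < n)%N.
Implicit Types (d t : 'I_n -> R) (i j k c m p q r : 'I_n) (S X Y : {set 'I_n}).
Let T0 := @standard_tiling n.

Lemma polygon_edge_comb (z : R[i]) : polygon n z ->
  exists2 t, (forall k, 0 <= t k <= 1) & z = edge_comb t.
Proof.
move=> [w [w0 w1 ->]]; exists (fun k => \sum_S w S * (k \in S)%:R).
  move=> k; rewrite sumr_ge0 => [|S _]; last by rewrite mulr_ge0 // ler0n.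
  rewrite -[leRHS]w1; apply: ler_sum => S _; rewrite ler_piMr ?w0 //.
  by rewrite lern1 leq_b1.
rewrite /edge_comb; under [RHS]eq_bigr do rewrite rmorph_sum big_distrl /=.
rewrite exchange_big /=; apply: eq_bigr => S _; rewrite pt_edge_comb /edge_comb big_distrr /=.
by apply: eq_bigr => k _; rewrite rmorphM /= mulrA.
Qed.

(** The weights are the bilinear ones of the four corners. *)
Lemma rhombus_polygon S i j (z : R[i]) : i != j -> i \notin S -> j \notin S ->
  rhombus S i j z -> polygon n z.
Proof.
move=> ij iS jS [s [t [/andP[s0 s1] /andP[t0 t1] ->]]].
pose L : seq ({set 'I_n} * R) := [:: (S, (1 - s) * (1 - t)); (i |: S, s * (1 - t));
  (j |: S, (1 - s) * t); (i |: (j |: S), s * t)].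
pose w X := \sum_(e <- L) (X == e.1)%:R * e.2.
have wE (f : {set 'I_n} -> R[i]) :
    \sum_X (w X)%:C%C * f X = \sum_(e <- L) (e.2)%:C%C * f e.1.
  under eq_bigr do rewrite rmorph_sum big_distrl /=.
  rewrite exchange_big /=; apply: eq_bigr => e _.
  rewrite (bigD1 e.1) //= eqxx mul1r big1 ?addr0 // => X /negbTE ->.
  by rewrite mul0r rmorph0 mul0r.
exists w; split.
- move=> X; rewrite /w !big_cons big_nil /= addr0.
  by rewrite !addr_ge0 // mulr_ge0 ?ler0n // mulr_ge0 ?subr_ge0.
- apply: (@complexI R); rewrite rmorph_sum /=.
  under eq_bigr do rewrite -[(w _)%:C%C]mulr1.
  rewrite (wE (fun=> 1)) !big_cons big_nil /= !rmorphM !rmorphB !rmorph1.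
  by ring.
- rewrite wE !big_cons big_nil /= !rmorphM !rmorphB !rmorph1.
  rewrite !pt_setU1 // ?inE ?negb_or ?ij //.
  by ring.
Qed.

Lemma row_sum_continuous (c : 'I_n -> R) :
  continuous (fun v : 'rV[R]_n => \sum_k v ord0 k * c k).
Proof.
rewrite /index_enum; elim: (Finite.enum _) => [|k s IH] v.
  rewrite (_ : (fun _ => _) = cst 0); first exact: cst_continuous.
  by apply/funext => u; rewrite big_nil.
rewrite (_ : (fun _ => _) = (fun u : 'rV[R]_n => u ord0 k * c k) +
    (fun u : 'rV[R]_n => \sum_(l <- s) u ord0 l * c l)); last first.
  by apply/funext => u; rewrite big_cons.
apply: continuousD; last exact: IH.
by apply: continuousM; [exact: coord_continuous | exact: cst_continuous].
Qed.

(** The fibre is a closed subset of a cube, and the coefficient sum is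
continuous. *)
Lemma minimal_edge_comb t0 : (forall k, 0 <= t0 k <= 1) ->
  exists t, [/\ forall k, 0 <= t k <= 1, edge_comb t = edge_comb t0 &
    forall t', (forall k, 0 <= t' k <= 1) -> edge_comb t' = edge_comb t0 ->
      \sum_k t k <= \sum_k t' k].
Proof.
move=> t01.
pose a := \sum_k t0 k * cos (angle R k); pose b := \sum_k t0 k * sin (angle R k).
pose box : set 'rV[R]_n := [set v | forall k, `[0, 1]%classic (v ord0 k)]%classic.
pose fc (v : 'rV[R]_n) := \sum_k v ord0 k * cos (angle R k).
pose fs (v : 'rV[R]_n) := \sum_k v ord0 k * sin (angle R k).
pose A := (box `&` (fc @^-1` [set x | x = a] `&` fs @^-1` [set x | x = b]))%classic.
have cbox : compact box.
  apply: (@rV_compact R n (fun=> `[(0 : R), 1]%classic)) => k; exact: segment_compact.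
have cA : compact A.
  apply: compact_closedI => //; apply: closedI.
    exact: ((continuous_closedP fc).1
      (row_sum_continuous (c := fun k => cos (angle R k))) _ (closed_eq (y := a))).
  exact: ((continuous_closedP fs).1
    (row_sum_continuous (c := fun k => sin (angle R k))) _ (closed_eq (y := b))).
have inA t : (forall k, 0 <= t k <= 1) -> edge_comb t = edge_comb t0 -> A (\row_k t k).
  move=> t_01 e; have [ec es] := edge_comb_eq e; split=> [k|]; first by rewrite /= mxE in_itv /=.
  split; rewrite /= ?/fc ?/fs.
    by under eq_bigr do rewrite mxE.
  by under eq_bigr do rewrite mxE.
pose f (v : 'rV[R]_n) := \sum_k v ord0 k * 1.
have A0 : (A !=set0)%classic by exists (\row_k t0 k); apply: inA.
have [|v vA vmin] := EVT_min_rV (f := f) A0 cA.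
  by apply: continuous_subspaceT; exact: row_sum_continuous.
have [vbox [vc vs]] := set_mem vA.
exists (fun k => v ord0 k); split.
- by move=> k; have := vbox k; rewrite /= in_itv.
- by rewrite !edge_combE -[X in (X +i* _)%C]/(fc v) -[X in (_ +i* X)%C]/(fs v) vc vs.
- move=> t' t'01 e; have := vmin _ (mem_set (inA _ t'01 e)).
  rewrite /f; under eq_bigr do rewrite mulr1.
  by under [X in _ <= X -> _]eq_bigr do rewrite mxE mulr1.
Qed.

Lemma sum_delta (f : 'I_n -> R) p : \sum_k (k == p)%:R * f k = f p.
Proof.
rewrite (bigD1 p) //= eqxx mul1r big1 ?addr0 // => k /negbTE ->.
by rewrite mul0r.
Qed.

(** For [p < q < r] the vector [e_q] is a positive combination of [e_p] and [e_r]
whose coefficients have a sum larger than 1.  Shifting weight from [p] and [r]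
to [q] would thus lower the coefficient sum. *)
Lemma minimal_gap t p q r : (forall k, 0 <= t k <= 1) ->
  (forall t', (forall k, 0 <= t' k <= 1) -> edge_comb t' = edge_comb t ->
      \sum_k t k <= \sum_k t' k) ->
  (p < q)%N -> (q < r)%N -> 0 < t p -> 0 < t r -> t q = 1.
Proof.
move=> t01 tmin pq qr tp tr; apply/eqP; rewrite eq_le (andP (t01 q)).2 /= leNgt.
apply/negP => tq; have pr := ltn_trans pq qr.
(* The edge vectors satisfy [al * e_p + be * e_r = ga * e_q]. *)
pose al := sin (angle R r - angle R q); pose be := sin (angle R q - angle R p).
pose ga := sin (angle R r - angle R p).
have al0 : 0 < al by apply: sin_angle_gt0.
have be0 : 0 < be by apply: sin_angle_gt0.
have ga0 : 0 < ga by apply: sin_angle_gt0.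
have gab : ga < al + be.
  have -> : ga = al * cos (angle R q - angle R p) + cos (angle R r - angle R q) * be.
    by rewrite /al /be -sinD; congr sin; ring.
  apply: ltr_leD; last by rewrite ler_piMl ?cos_le1 // ltW.
  rewrite gtr_pMr // lt_neqAle cos_le1 andbT; apply/eqP => c1.
  have := cos2Dsin2 (angle R q - angle R p).
  rewrite c1 expr1n -/be => /eqP; rewrite -subr_eq0 addrAC subrr add0r sqrf_eq0.
  by rewrite gt_eqF.
(* The largest shift that keeps all coefficients in [0, 1]. *)
pose eps := Num.min (t p / al) (Num.min (t r / be) ((1 - t q) / ga)).
have eps0 : 0 < eps by rewrite !lt_min !divr_gt0 // subr_gt0.
have ep : eps * al <= t p by rewrite -ler_pdivlMr // ge_min lexx.
have er : eps * be <= t r by rewrite -ler_pdivlMr // !ge_min lexx orbT.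
have eq' : eps * ga <= 1 - t q by rewrite -ler_pdivlMr // !ge_min lexx !orbT.
have [eal ebe ega] : [/\ 0 < eps * al, 0 < eps * be & 0 < eps * ga] by rewrite !mulr_gt0.
pose d k : R := (k == p)%:R * - (eps * al) + (k == q)%:R * (eps * ga) + (k == r)%:R * - (eps * be).
have sumd f : \sum_k d k * f k = - (eps * al) * f p + eps * ga * f q - (eps * be) * f r.
  transitivity (\sum_k (k == p)%:R * (- (eps * al) * f k)
      + \sum_k (k == q)%:R * (eps * ga * f k) + \sum_k (k == r)%:R * (- (eps * be) * f k)).
    by rewrite -!big_split; apply: eq_bigr => k _; rewrite /d /=; ring.
  by rewrite !(sum_delta (fun k => _ * f k)) [- (eps * be) * _]mulNr.
have dcomb : edge_comb d = 0.
  rewrite edge_combE !sumd /al /be /ga !sinB; apply/eqP; rewrite eq_complex /=.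
  by apply/andP; split; apply/eqP; ring.
have := tmin (fun k => t k + d k); rewrite edge_combD dcomb addr0 => /(_ _ erefl).
have dE : \sum_k d k = \sum_k d k * 1 by under [RHS]eq_bigr do rewrite mulr1.
rewrite big_split /= dE sumd !mulr1.
have npq : (p == q) = false by rewrite -val_eqE ltn_eqF.
have nqr : (q == r) = false by rewrite -val_eqE ltn_eqF.
have npr : (p == r) = false by rewrite -val_eqE ltn_eqF.
have := t01 p; have := t01 q; have := t01 r.
move=> /andP[r0 r1] /andP[q0 q1] /andP[p0 p1] H.
have {}H : \sum_k t k <= \sum_k t k + (- (eps * al) + eps * ga - eps * be).
  apply: H => k; rewrite /d; have /andP[k0 k1] := t01 k.
  have [->|kp] := eqVneq k p; first by rewrite ?eqxx npq npr /= ?mulr1n ?mulr0n; lra.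
  have [->|kq] := eqVneq k q; first by rewrite ?eqxx nqr /= ?mulr1n ?mulr0n; lra.
  by have [->|kr] := eqVneq k r; rewrite /= ?mulr1n ?mulr0n; lra.
have : 0 < eps * (al + be - ga) by rewrite mulr_gt0 // subr_gt0.
by lra.
Qed.

(** A representation with the least coefficient sum has no gap: strictly between
two nonzero coefficients all coefficients are 1. *)
Lemma standard_cover (z : R[i]) :
  polygon n z <-> exists i j, (i < j)%N /\ rhombus (T0 i j) i j z.
Proof.
split=> [/polygon_edge_comb[t0 t01 ->]|[i [j [ij]]]]; last first.
  apply: rhombus_polygon; rewrite ?inE ?ltnn ?andbF //.
  by rewrite -val_eqE ltn_eqF.
have [t [{}t01 <- tmin]] := minimal_edge_comb t01.
suff [i [j [ij tE]]] : exists i j, (i < j)%N /\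
    forall k, t k = profile i j (t i) (t j) k.
  exists i, j; split=> //; exists (t i), (t j); split=> //.
  by rewrite rhombus_profile //; apply: eq_bigr => k _; rewrite tE.
have tge k : 0 <= t k by case/andP: (t01 k).
have tz k : ~~ (0 < t k) -> t k = 0 by rewrite -leNgt => h; apply/eqP; rewrite eq_le h tge.
have n0 : (0 < n)%N by apply: ltn_trans n1.
have pair a : exists i j, (i < j)%N /\ (a \in [:: i; j]) /\ forall k, ~~ (i < k < j)%N.
  case: (ltnP a.+1 n) => an.
    exists a, (Ordinal an); split=> //; split; first by rewrite inE eqxx.
    by move=> k /=; lia.
  have an' : (a.-1 < n)%N by have := ltn_ord a; lia.
  exists (Ordinal an'), a; split; first by rewrite /=; lia.
  by split=> [|k /=]; [rewrite !inE eqxx orbT | lia].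
have single a : (forall k, k != a -> t k = 0) -> exists i j, (i < j)%N /\
    forall k, t k = profile i j (t i) (t j) k.
  move=> ta; have [i [j [ij [aij gap]]]] := pair a.
  exists i, j; split=> // k; rewrite /profile; case: eqVneq => [->//|ki].
  case: eqVneq => [->//|kj]; rewrite (negbTE (gap k)) ta //.
  by apply: contraTneq aij => <-; rewrite !inE negb_or ki.
case: (pselect (exists k, 0 < t k)) => [[k0 tk0]|none]; last first.
  apply: (single (Ordinal n0)) => k _; apply: tz; apply/negP => tk; apply: none.
  by exists k.
have [a ta amin] := arg_minnP (fun k : 'I_n => val k) (P := fun k => 0 < t k) tk0.
have [b tb bmax] := arg_maxnP (fun k : 'I_n => val k) (P := fun k => 0 < t k) tk0.
have ab : (a <= b)%N := amin b tb.
have out k : (k < a)%N || (b < k)%N -> t k = 0.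
  move=> h; apply: tz; apply/negP => tk; have := amin k tk; have := bmax k tk.
  by move: h => /=; lia.
case: (eqVneq a b) => [e|nab].
  apply: (single a) => k ka; apply: out; move: ka; rewrite -e -val_eqE /=; lia.
have lt_ab : (a < b)%N by rewrite ltn_neqAle nab.
exists a, b; split=> // k; rewrite /profile.
case: eqVneq => [->//|ka]; case: eqVneq => [->//|kb].
case: (boolP (a < k < b)%N) => [/andP[ak kb']|h].
  apply: (minimal_gap t01 _ ak kb' ta tb) => t' t'01 e.
  by apply: tmin.
by apply: out; move: h ka kb; rewrite -!val_eqE /=; lia.
Qed.

Lemma standard_is_tiling : is_tiling R T0.
Proof.
split.
- by move=> i j ij; rewrite !inE !ltnn andbF.
- exact: standard_cover.
- exact: standard_disjoint.
- exact: standard_label.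
Qed.

End Cover.

(** * Networks equivalent to the network of a matrix *)

Section HexagonCells.
Variable n : nat.
Implicit Types (T : tiles n) (S X : {set 'I_n}) (i j p q r : 'I_n).

(** The six cube vertices on the boundary of the hexagon, which both
configurations share. *)
Definition outer_vertices S p q r : seq {set 'I_n} :=
  [:: S; p |: S; r |: S; p |: (q |: S); q |: (r |: S); p |: (q |: (r |: S))].

Let setE p q r S : [/\ p |: (r |: (q |: S)) = p |: (q |: (r |: S)),
   q |: (p |: S) = p |: (q |: S), r |: (q |: S) = q |: (r |: S) &
   q |: (r |: (p |: S)) = p |: (q |: (r |: S))].
Proof.
by split; apply/setP => x; rewrite !inE; case: (x == p); case: (x == q); case: (x == r).
Qed.

Lemma hexagon_q_vertex T S p q r : (p < q < r)%N -> hexagon_q T S p q r ->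
  is_vertex T (q |: S) /\ forall X, X \in outer_vertices S p q r -> is_vertex T X.
Proof.
move=> /andP[pq qr] [Tpq Tqr Tpr]; have pr := ltn_trans pq qr.
have [e1 e2 e3 e4] := setE p q r S.
split=> [|X]; first by exists p, q; rewrite Tpq !inE eqxx !orbT.
rewrite !inE => /orP[/eqP->|/or4P[/eqP->|/eqP->|/eqP->|/orP[]/eqP->]].
- by exists p, q; rewrite Tpq !inE eqxx.
- by exists p, q; rewrite Tpq !inE eqxx !orbT.
- by exists q, r; rewrite Tqr !inE eqxx !orbT.
- by exists p, q; rewrite Tpq !inE eqxx !orbT.
- by exists q, r; rewrite Tqr !inE eqxx !orbT.
- by exists p, r; rewrite Tpr !inE e1 eqxx !orbT.
Qed.

Lemma hexagon_pr_vertex T S p q r : (p < q < r)%N -> hexagon_pr T S p q r ->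
  is_vertex T (p |: (r |: S)) /\ forall X, X \in outer_vertices S p q r -> is_vertex T X.
Proof.
move=> /andP[pq qr] [Tpr Tpq Tqr]; have pr := ltn_trans pq qr.
have [e1 e2 e3 e4] := setE p q r S.
split=> [|X]; first by exists p, r; rewrite Tpr !inE eqxx !orbT.
rewrite !inE => /orP[/eqP->|/or4P[/eqP->|/eqP->|/eqP->|/orP[]/eqP->]].
- by exists p, r; rewrite Tpr !inE eqxx.
- by exists p, r; rewrite Tpr !inE eqxx !orbT.
- by exists p, r; rewrite Tpr !inE eqxx !orbT.
- by exists q, r; rewrite Tqr !inE e2 eqxx !orbT.
- by exists p, q; rewrite Tpq !inE eqxx !orbT.
- by exists p, q; rewrite Tpq !inE eqxx !orbT.
Qed.

Lemma outer_not_center S p q r X : (p < q < r)%N ->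
  [/\ p \notin S, q \notin S & r \notin S] -> X \in outer_vertices S p q r ->
  X <> q |: S /\ X <> p |: (r |: S).
Proof.
move=> /andP[pq qr] [/negbTE pS /negbTE qS /negbTE rS].
have npq : (p == q) = false by rewrite -val_eqE ltn_eqF.
have nqr : (q == r) = false by rewrite -val_eqE ltn_eqF.
have npr : (p == r) = false by rewrite -val_eqE ltn_eqF // (ltn_trans pq).
have N := (npq, nqr, npr, eq_sym q p, eq_sym r q, eq_sym r p, pS, qS, rS).
rewrite !inE => XO; split=> e; move: XO; rewrite {}e.
  move=> /orP[/eqP|/or4P[/eqP|/eqP|/eqP|/orP[]/eqP]] e;
    have := congr1 (fun Y : {set 'I_n} => (p \in Y, q \in Y, r \in Y)) e;
    by rewrite !inE !eqxx ?N.
move=> /orP[/eqP|/or4P[/eqP|/eqP|/eqP|/orP[]/eqP]] e;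
  have := congr1 (fun Y : {set 'I_n} => (p \in Y, q \in Y, r \in Y)) e;
  by rewrite !inE !eqxx ?N.
Qed.

Lemma other_in_U T T' p q r c : same_other_tiles T T' p q r ->
  in_U T' c -> in_U T c \/ exists i j, [/\ (i < j)%N, (i, j) \in [:: (p, q); (p, r); (q, r)] &
    match c with
    | Vertex X => X \in [:: T' i j; i |: T' i j; j |: T' i j; i |: (j |: T' i j)]
    | Face X k l => [/\ X = T' i j, k = i & l = j] end].
Proof.
move=> same; case: c => [X|X k l] /=.
  move=> [i [j [ij Xij]]]; case: (boolP ((i, j) \in [:: (p, q); (p, r); (q, r)])) => h.
    by right; exists i, j.
  by left; exists i, j; rewrite -(same _ _ ij h).
move=> [kl ->]; case: (boolP ((k, l) \in [:: (p, q); (p, r); (q, r)])) => h.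
  by right; exists k, l.
by left; rewrite (same _ _ kl h).
Qed.

Lemma in_U_up T T' S p q r c : (p < q < r)%N ->
  hexagon_q T S p q r -> hexagon_pr T' S p q r -> same_other_tiles T T' p q r ->
  in_U T' c -> ~ center_pr S p q r c -> in_U T c.
Proof.
move=> pqr hq [Tpr Tpq Tqr] same c' nc.
have [_ out] := hexagon_q_vertex pqr hq.
have [e1 e2 e3 e4] := setE p q r S.
case: (other_in_U same c') => // -[i [j [ij]]]; case: c c' nc => [X|X k l] _ nc.
  rewrite !inE => /or3P[]/eqP[-> ->]; rewrite ?Tpr ?Tpq ?Tqr ?e2 ?e4 => /or4P[]/eqP XE;
    rewrite XE in nc *; try by apply: out; rewrite !inE eqxx ?orbT.
  1-3: by case: nc; apply: Or41; rewrite // finset.setUCA.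
rewrite !inE => /or3P[]/eqP[-> ->] [XE kE lE]; subst X k l; case: nc.
- by rewrite Tpq; apply: Or43.
- by rewrite Tpr; apply: Or42.
- by rewrite Tqr; apply: Or44.
Qed.

Lemma in_U_down T T' S p q r c : (p < q < r)%N ->
  hexagon_pr T S p q r -> hexagon_q T' S p q r -> same_other_tiles T T' p q r ->
  in_U T' c -> ~ center_q S p q r c -> in_U T c.
Proof.
move=> pqr hq [Tpq Tqr Tpr] same c' nc.
have [_ out] := hexagon_pr_vertex pqr hq.
have [e1 e2 e3 e4] := setE p q r S.
case: (other_in_U same c') => // -[i [j [ij]]]; case: c c' nc => [X|X k l] _ nc.
  rewrite !inE => /or3P[]/eqP[-> ->]; rewrite ?Tpr ?Tpq ?Tqr ?e1 ?e3 => /or4P[]/eqP XE;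
    rewrite XE in nc *; try by apply: out; rewrite !inE eqxx ?orbT.
  1-3: by case: nc; apply: Or41.
rewrite !inE => /or3P[]/eqP[-> ->] [XE kE lE]; subst X k l; case: nc.
- by rewrite Tpq; apply: Or42.
- by rewrite Tpr; apply: Or44.
- by rewrite Tqr; apply: Or43.
Qed.

End HexagonCells.

Section Generic.
Variables (K : fieldType) (n : nat).
Hypothesis n1 : (1 < n)%N.
Implicit Types (A : 'M[K]_n) (S X : {set 'I_n}) (i j p q r : 'I_n).
Let T0 := @standard_tiling n.

(** Each face and each subset occurs in a tiling reached by a sweep. *)
Lemma generic_of_equiv A :
  (forall N : network K n, net_equiv (T0, mx_network A) N ->
     forall c, in_U N.1 c -> N.2 c != 0) -> generic_mx A.
Proof.
move=> nz.
have reach S i j : (i < j)%N -> i \notin S -> j \notin S ->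
    exists2 T, T i j = S & forall c, in_U T c -> mx_network A c != 0.
  move=> ij iS jS; have [u sep uS] := exists_sweep ij iS jS.
  by exists (sweep u 0) => // c; apply: (nz _ (sweep_reach nz 0 sep)).
have face S i j : (i < j)%N -> i \notin S -> j \notin S ->
    mx_network A (Face S i j) != 0.
  by move=> ij iS jS; have [T <- ] := reach S i j ij iS jS; apply.
split=> [S|S i j nij iS jS oij].
  pose i := Ordinal (ltn_trans (ltnSn 0) n1); pose j := Ordinal n1.
  have [||T TS] := reach (S :\ i :\ j) i j isT.
  - by rewrite !inE eqxx andbF.
  - by rewrite !inE eqxx.
  move=> /(_ (Vertex S)); rewrite /= mulf_eq0 negb_or => nzS.
  suff /nzS/andP[] : is_vertex T S by [].
  exists i, j; split=> //; rewrite TS !inE.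
  have mem (Y : {set 'I_n}) : (forall x, (x \in Y) = (x \in S)) -> S == Y.
    by move=> h; apply/eqP/setP => x.
  case: (boolP (i \in S)) => iS; case: (boolP (j \in S)) => jS.
  - apply/or4P/Or44/mem => x; rewrite !inE.
    by case: eqVneq => [->|_] //=; case: eqVneq => [->|_].
  - apply/or4P/Or42/mem => x; rewrite !inE.
    by case: eqVneq => [->|_] //=; case: eqVneq => [->|_] //=; rewrite (negbTE jS).
  - apply/or4P/Or43/mem => x; rewrite !inE.
    by case: eqVneq => [->|_] //=; case: eqVneq => [->|_] //=; rewrite (negbTE iS).
  - apply/or4P/Or41/mem => x; rewrite !inE.
    case: eqVneq => [->|_] /=; first by rewrite (negbTE jS).
    by case: eqVneq => [->|_] //=; rewrite (negbTE iS).
have [lt|lt|/val_inj e] := ltngtP i j; last by rewrite e eqxx in nij.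
  have := face S i j lt iS jS; rewrite mx_network_face // mulf_eq0 negb_or.
  by move: oij; rewrite odd_apE // ltnNge ltnW //= => -> /andP[].
have := face S j i lt jS iS; rewrite mx_network_face // mulf_eq0 negb_or.
by move: oij; rewrite odd_apE // lt /= => /negbTE-> /andP[].
Qed.

(** Each relation is linear in one unknown, with nonzero coefficient. *)
Lemma hexahedron_unique (a0 a1 a2 a3 a4 a5 a6 a7 a8 a9 b0 b1 b2 b3 c0 c1 c2 c3 : K) :
  a0 != 0 -> a1 != 0 -> a2 != 0 -> a3 != 0 ->
  hexahedron a0 a1 a2 a3 a4 a5 a6 a7 a8 a9 b0 b1 b2 b3 ->
  hexahedron a0 a1 a2 a3 a4 a5 a6 a7 a8 a9 c0 c1 c2 c3 ->
  [/\ b0 = c0, b1 = c1, b2 = c2 & b3 = c3].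
Proof.
move=> n0 n1' n2 n3 [e1 e2 e3 e4] [f1 f2 f3 f4]; split.
- have := etrans e4 (esym f4).
  by move=> /(mulIf n3)/(mulIf n2)/(mulIf n1')/(mulIf (expf_neq0 2 n0)).
- by have := etrans e1 (esym f1) => /(mulIf n0)/(mulIf n1').
- by have := etrans e2 (esym f2) => /(mulIf n0)/(mulIf n2).
- by have := etrans e3 (esym f3) => /(mulIf n0)/(mulIf n3).
Qed.

Definition tiles_notin (T : tiles n) :=
  forall i j, (i < j)%N -> i \notin T i j /\ j \notin T i j.

(** The invariant of cube moves and rescalings started at a network of [A].  The
label condition ensures that the faces carry almost-principal minors. *)
Definition follows A (N : network K n) := tiles_notin N.1 /\
  exists2 a : K, a != 0 & forall c, in_U N.1 c -> N.2 c = a * mx_network A c.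

Lemma generic_face A S i j : generic_mx A -> (i < j)%N -> i \notin S -> j \notin S ->
  mx_network A (Face S i j) != 0.
Proof.
move=> [_ gA] ij iS jS; rewrite mx_network_face // mulf_neq0 ?sigma_neq0 //.
have nij : i != j by rewrite -val_eqE ltn_eqF.
case: ifP => o; apply: gA; rewrite // 1?eq_sym // odd_apE // 1?eq_sym // ?o ?ij //.
by rewrite ltnNge ltnW.
Qed.

Lemma generic_vertex A S : generic_mx A -> mx_network A (Vertex S) != 0.
Proof. by move=> [gA _]; rewrite /= mulf_neq0 ?sigma_neq0. Qed.

Lemma follows_neq0 A N : generic_mx A -> follows A N -> forall c, in_U N.1 c -> N.2 c != 0.
Proof.
move=> gA [nT [a a0 eN]] [X|X i j] cU; rewrite eN // mulf_neq0 //.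
  exact: generic_vertex.
by case: cU => ij ->; have [iT jT] := nT _ _ ij; apply: generic_face.
Qed.

Lemma generic_hexahedron A S p q r : generic_mx A -> (p < q < r)%N ->
  [/\ p \notin S, q \notin S & r \notin S] ->
  hexahedron_at (mx_network A) (mx_network A) S p q r.
Proof. by move=> [gA _] pqr nS; apply: mx_hexahedron. Qed.

(** Up to the factor [a], the values of [A] solve the hexahedron relation, and its
solution is unique. *)
Lemma follows_up A N N' : generic_mx A -> cube_move_up N N' -> follows A N -> follows A N'.
Proof.
case: N N' => [T F] [T' F'] gA [S [p [q [r [pqr [nS [hq hpr same hex rest]]]]]]].
move=> [nT [a a0 eN]]; rewrite /= in hq hpr same hex rest nT eN *.
have [pq qr] := andP pqr; have pr := ltn_trans pq qr.
have [pS qS rS] := nS; have [Tpq Tqr Tpr] := hq; have [Tpr' Tpq' Tqr'] := hpr.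
have npq : (p == q) = false by rewrite -val_eqE ltn_eqF.
have nqr : (q == r) = false by rewrite -val_eqE ltn_eqF.
have npr : (p == r) = false by rewrite -val_eqE ltn_eqF // (ltn_trans pq).
have [vq vout] := hexagon_q_vertex pqr hq.
split=> [i j ij|] /=.
  case: (boolP ((i, j) \in [:: (p, q); (p, r); (q, r)])) => h; last first.
    by rewrite same //; apply: nT.
  move: h; rewrite !inE => /or3P[]/eqP[-> ->]; rewrite ?Tpq' ?Tpr' ?Tqr' ?inE //.
  - by rewrite npr nqr.
  - by rewrite !negb_or ![_ == p]eq_sym npq npr.
exists a => // c c'.
case: (pselect (center_pr S p q r c)) => [cc|nc]; last first.
  by rewrite rest // eN //; apply: (in_U_up pqr hq hpr).
have vO X : X \in outer_vertices S p q r -> F (Vertex X) = a * mx_network A (Vertex X).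
  by move=> XO; apply: eN; apply: vout.
have H := hexahedron_scale a (generic_hexahedron gA pqr nS).
move: hex; rewrite /hexahedron_at (eN (Vertex (q |: S))) //.
rewrite (eN (Face S p q)) // (eN (Face (q |: S) p r)) // (eN (Face S q r)) //.
rewrite !vO ?inE ?eqxx ?orbT //.
move=> /(hexahedron_unique _ _ _ _)/(_ H) [].
- by rewrite mulf_neq0 ?generic_vertex.
- by rewrite mulf_neq0 ?generic_face.
- by rewrite mulf_neq0 ?generic_face // !inE negb_or ?npq // eq_sym nqr.
- by rewrite mulf_neq0 ?generic_face.
by move=> E0 E1 E2 E3; case: cc => ->.
Qed.

(** The antipodal form of the relation determines the unstarred values, and the
values of [A] satisfy it by [hexahedron_antipode]. *)
Lemma follows_down A N N' : generic_mx A -> cube_move_down N N' -> follows A N -> follows A N'.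
Proof.
case: N N' => [T F] [T' F'] gA [S [p [q [r [pqr [nS [hpr hq same [_ hex] rest]]]]]]].
move=> [nT [a a0 eN]]; rewrite /= in hq hpr same hex rest nT eN *.
have [pq qr] := andP pqr; have pr := ltn_trans pq qr.
have [pS qS rS] := nS; have [Tpq' Tqr' Tpr'] := hq; have [Tpr Tpq Tqr] := hpr.
have npq : (p == q) = false by rewrite -val_eqE ltn_eqF.
have nqr : (q == r) = false by rewrite -val_eqE ltn_eqF.
have npr : (p == r) = false by rewrite -val_eqE ltn_eqF // (ltn_trans pq).
have [vq vout'] := hexagon_q_vertex pqr hq.
have [vpr vout] := hexagon_pr_vertex pqr hpr.
split=> [i j ij|] /=.
  case: (boolP ((i, j) \in [:: (p, q); (p, r); (q, r)])) => h; last first.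
    by rewrite same //; apply: nT.
  move: h; rewrite !inE => /or3P[]/eqP[-> ->]; rewrite ?Tpq' ?Tpr' ?Tqr' ?inE //.
  by rewrite !negb_or npq [r == q]eq_sym nqr.
exists a => // c c'.
case: (pselect (center_q S p q r c)) => [cc|nc]; last first.
  by rewrite rest // eN //; apply: (in_U_down pqr hpr hq).
have vO X : X \in outer_vertices S p q r -> F' (Vertex X) = a * mx_network A (Vertex X).
  move=> XO; rewrite rest; first by apply: eN; apply: vout.
    exact: vout'.
  by have [nq _] := outer_not_center pqr nS XO; case=> // -[/nq].
have nzf : [/\ mx_network A (Vertex (q |: S)) != 0, mx_network A (Face S p q) != 0,
    mx_network A (Face (q |: S) p r) != 0 & mx_network A (Face S q r) != 0].
  split; rewrite ?generic_vertex ?generic_face // !inE negb_or ?npq //.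
  by rewrite eq_sym nqr.
have [z0 z1 z2 z3] := nzf.
have H := hexahedron_scale a (hexahedron_antipode z0 z1 z2 z3 (generic_hexahedron gA pqr nS)).
move: hex; rewrite /hexahedron_antipodal_at (eN (Vertex (p |: (r |: S)))) //.
rewrite (eN (Face (r |: S) p q)) // (eN (Face S p r)) // (eN (Face (p |: S) q r)) //.
rewrite (vO S) ?(vO (p |: S)) ?(vO (r |: S)) ?(vO (p |: (q |: S))) ?(vO (q |: (r |: S)))
  ?(vO (p |: (q |: (r |: S)))) ?inE ?eqxx ?orbT //.
move=> /(hexahedron_unique _ _ _ _)/(_ H) [].
- by rewrite mulf_neq0 ?generic_vertex.
- by rewrite mulf_neq0 ?generic_face // !inE negb_or ?npr ?nqr.
- by rewrite mulf_neq0 ?generic_face.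
- by rewrite mulf_neq0 ?generic_face // !inE negb_or eq_sym ?npq ?npr.
by move=> E0 E1 E2 E3; case: cc => ->.
Qed.

Lemma follows_step A N N' : generic_mx A -> network_step N N' -> follows A N -> follows A N'.
Proof.
move=> gA [up|down|[eT [b b0 eF]]]; [exact: follows_up|exact: follows_down|].
move=> [nT [a a0 eN]]; rewrite /follows eT; split=> //.
exists (b * a); first by rewrite mulf_neq0.
by move=> c cU; rewrite eF // eN // mulrA.
Qed.

Lemma generic_equiv A : generic_mx A -> forall N : network K n,
  net_equiv (T0, mx_network A) N -> forall c, in_U N.1 c -> N.2 c != 0.
Proof.
move=> gA N eqN; apply: (follows_neq0 gA).
have: follows A (T0, mx_network A).
  split=> [i j ij|]; first by rewrite /T0 /= !inE !ltnn andbF.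
  by exists 1; rewrite ?oner_eq0 // => c _; rewrite mul1r.
suff equiv_follows N1 N2 : net_equiv N1 N2 -> follows A N1 -> follows A N2.
  exact: equiv_follows eqN.
elim=> {N1 N2} [N1 N2 st|//|N1 N2 N3 _ IH1 _ IH2 f1]; last by apply: IH2; apply: IH1.
exact: follows_step.
Qed.

End Generic.

Theorem theorem4p2 (R : realType) (n : nat) (hn : (1 < n)%N) :
  (forall F : cell n -> R[i],
     generic_network (@standard_tiling n, F) -> F (Vertex finset.set0) = 1 ->
     exists! A : 'M[R[i]]_n,
       generic_mx A /\ eq_on_U (@standard_tiling n) (mx_network A) F) /\
  exists Psi : (cell n -> R[i]) -> 'M[R[i]]_n,
    (forall F : cell n -> R[i],
       generic_network (@standard_tiling n, F) -> F (Vertex finset.set0) = 1 ->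
       generic_mx (Psi F) /\
       eq_on_U (@standard_tiling n) (mx_network (Psi F)) F) /\
    (forall A : 'M[R[i]]_n, generic_mx A ->
       generic_network (@standard_tiling n, mx_network A) /\
       mx_network A (Vertex finset.set0) = 1 /\
       forall F : cell n -> R[i],
         eq_on_U (@standard_tiling n) (mx_network A) F -> Psi F = A).
Proof.
set T0 := @standard_tiling n.
pose sol (F : cell n -> R[i]) (A : 'M[R[i]]_n) := generic_mx A /\ eq_on_U T0 (mx_network A) F.
have sol_uniq F A A' : sol F A -> sol F A' -> A = A'.
  move=> [gA eA] [_ eA']; apply: (mx_network_inj hn).
    exact: (generic_equiv gA (rt_refl _ _ _)).
  by move=> c cU; rewrite eA // eA'.
have sol_ex (F : cell n -> R[i]) : generic_network (T0, F) -> F (Vertex finset.set0) = 1 ->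
    exists A, sol F A.
  move=> [_ nz] F0.
  have [|A eA] := mx_network_surj hn F0; first exact: (nz _ (rt_refl _ _ _)).
  exists A; split=> //; apply: (generic_of_equiv hn) => N eqN; apply: nz.
  apply: rt_trans eqN; apply: rt_step; apply: Or33; split=> //.
  by exists 1; rewrite ?oner_eq0 // => c cU; rewrite /= mul1r eA.
split=> [F gF F0|].
  by have [A sA] := sol_ex F gF F0; exists A; split=> // A'; apply: sol_uniq.
exists (fun F => xget 0 (sol F)); split=> [F gF F0|A gA].
  by have [A sA] := sol_ex F gF F0; exact: (xgetPex 0 (ex_intro _ A sA)).
split; first exact: (conj (standard_is_tiling R hn) (generic_equiv gA)).
split; first by rewrite /= /sigma cards0 expr0 minor0 mul1r.
move=> F eF; have sA : sol F A by [].
exact: (sol_uniq F _ _ (xgetPex 0 (ex_intro _ A sA)) sA).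
Qed.
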